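(* Fix integers $m\ge 1$, $K\ge 1$ and reals $d,v,b>0$ and $0<w_0<w_c$. There exist constants $\nu,\nu'>0$, depending only on $d,v,b,w_c,w_0,K$ and $m$, such that for all payoffs $\mathbf T>\mathbf R>0$ and $\mathbf S>\mathbf P>0$ with $$\nu(\mathbf S+w_0)<\mathbf R\qquad\text{and}\qquad \nu'(2\mathbf P+w_0)<\mathbf T,$$ and for every initial configuration $\sigma$ containing at least two cooperators with positive wealth and at least one defector with positive wealth, the Demographic Prisoner's Dilemma process started from $\sigma$ satisfies $$\mathbb P_\sigma\big(\text{the cooperators and defectors of }\sigma\text{ never die}\big)>0,$$ i.e. with positive $\mathbb P_\sigma$-probability, $Y^i(t)>0$ for all $t\ge0$ and all particles $i$ that in $\sigma$ are cooperators or defectors with positive wealth.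
   Context: Demographic Prisoner's Dilemma (spatial model). A configuration is an element $\sigma=(X^i,Y^i,Z^i)_{1\le i\le K}$ of $E=\big((\mathbb Z/m\mathbb Z)^2\times\mathbb R\times\{-1,0,1\}\big)^K$. Here $X^i$ is the position, $Y^i$ the wealth and $Z^i$ the strategy of particle $i$: $Z^i=0$ means $i$ is a cooperator, $Z^i=1$ means $i$ is a defector, $Z^i=-1$ means $i$ is not yet born and does not play. A particle with non-positive wealth is dead: it no longer plays. The continuous-time Markov chain $(X(t),Y(t),Z(t))_{t\ge0}$ on $E$, with law $\mathbb P_\sigma$ when started from $\sigma$, evolves as follows, all Poisson processes and random choices being independent. (Moves) Each particle $i$ performs a continuous-time simple symmetric random walk of rate $d$ on $(\mathbb Z/m\mathbb Z)^2$: at rate $d$ it jumps to one of its four neighbours, chosen uniformly. (Games) Each unordered pair $\{i,j\}$ of distinct particles has a Poisson process of rate $v$. When it rings, if $X^i=X^j$, $Y^i>0$, $Y^j>0$ and $Z^i,Z^j\neq-1$, the two particles play and the payoffs are added to their wealths; otherwise nothing happens. Payoffs: two cooperators each receive $\mathbf R$; if a cooperator meets a defector, the cooperator receives $-\mathbf S$ and the defector $\mathbf T$; if two defectors meet, the pair of payoffs is $(-2\mathbf P,0)$ or $(0,-2\mathbf P)$ with probability $1/2$ each. (Births) Each particle $i$ has a Poisson process of rate $b$. When it rings, if $Z^i\ne-1$, $Y^i>w_c$ and there is some index $j$ with $Z^j=-1$, then such a $j$ is chosen uniformly at random and one sets $X^j\leftarrow X^i$, $Y^j\leftarrow w_0$,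 $Z^j\leftarrow Z^i$, $Y^i\leftarrow Y^i-w_0$; otherwise nothing happens. *)

(* Defs.v *)
From HB Require Import structures.
From mathcomp Require Export all_boot all_order all_algebra.
From mathcomp Require Export all_classical all_reals all_analysis.
Export Order.TTheory GRing.Theory Num.Theory.
Export numFieldNormedType.Exports.

Set Implicit Arguments.
Unset Strict Implicit.
Unset Printing Implicit Defensive.

Local Open Scope classical_set_scope.
Local Open Scope ring_scope.

(* [Unborn], [Cooperator], [Defector] stand for Z = -1, 0, 1. *)
Inductive strategy := Unborn | Cooperator | Defector.

Definition is_born (z : strategy) := if z is Unborn then false else true.
Definition is_coop (z : strategy) := if z is Cooperator then true else false.
Definition is_def (z : strategy) := if z is Defector then true else false.

(* The discrete torus (Z/mZ)^2 is ['I_m * 'I_m] with the cyclic successor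
   [ordS] and predecessor [ord_pred]; unlike ['Z_m] this is right for m = 1. *)
Record particle (R : realType) (m : nat) := Particle {
  position : 'I_m * 'I_m;
  wealth : R;
  strat : strategy }.

Definition config (R : realType) (m K : nat) := 'I_K -> particle R m.

Record payoffs (R : realType) := Payoffs {
  payT : R; payR : R; payS : R; payP : R }.

Definition alive (R : realType) (m : nat) (p : particle R m) : bool :=
  is_born (strat p) && (0 < wealth p).

(* The element of the list [s] selected by [u], which is uniform in [s] when
   [u] is uniform in [0, 1]; the value [x0] is only reached for u = 1. *)
Definition choose (R : realType) (T : Type) (x0 : T) (s : seq T) (u : R) : T :=
  nth x0 s (Num.truncn (u * (size s)%:R)).

(* For m <= 2 some of the four entries coincide. *)
Definition neighbours (m : nat) (x : 'I_m * 'I_m) : seq ('I_m * 'I_m) :=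
  [:: (ordS x.1, x.2); (ord_pred x.1, x.2); (x.1, ordS x.2); (x.1, ord_pred x.2)].

Definition set_particle (R : realType) (m K : nat) (s : config R m K) (i : 'I_K)
    (p : particle R m) : config R m K :=
  fun k => if k == i then p else s k.

Definition do_move (R : realType) (m K : nat) (i : 'I_K) (u : R)
    (s : config R m K) : config R m K :=
  let p := s i in
  let x := position p in
  set_particle s i
    (Particle (choose x (neighbours x) u) (wealth p) (strat p)).

(* Payoffs of the first and of the second player; the coin only matters when
   both are defectors. *)
Definition game_payoff (R : realType) (pay : payoffs R) (z z' : strategy)
    (heads : bool) : R * R :=
  match z, z' with
  | Cooperator, Cooperator => (payR pay, payR pay)
  | Cooperator, Defector => (- payS pay, payT pay)
  | Defector, Cooperator => (payT pay, - payS pay)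
  | Defector, Defector =>
      if heads then (- (2 * payP pay), 0) else (0, - (2 * payP pay))
  | _, _ => (0, 0)
  end.

Definition do_game (R : realType) (m K : nat) (pay : payoffs R) (i j : 'I_K)
    (u : R) (s : config R m K) : config R m K :=
  let p := s i in
  let q := s j in
  if [&& position p == position q, alive p & alive q] then
    let g := game_payoff pay (strat p) (strat q) (u < 2^-1) in
    set_particle
      (set_particle s i (Particle (position p) (wealth p + g.1) (strat p)))
      j (Particle (position q) (wealth q + g.2) (strat q))
  else s.

Definition unborn (R : realType) (m K : nat) (s : config R m K) : seq 'I_K :=
  [seq j <- enum 'I_K | ~~ is_born (strat (s j))].

Definition do_birth (R : realType) (m K : nat) (w0 wc : R) (i : 'I_K) (u : R)
    (s : config R m K) : config R m K :=
  let p := s i in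
  if is_born (strat p) && (wc < wealth p) then
    if unborn s is j0 :: _ then
      let j := choose j0 (unborn s) u in
      set_particle
        (set_particle s i (Particle (position p) (wealth p - w0) (strat p)))
        j (Particle (position p) w0 (strat p))
    else s
  else s.

(* [inl (inl i)] drives the moves of i, [inl (inr (i, j))] the games of the
   unordered pair {i, j} (listed with i < j), [inr i] the births from i. *)
Definition clock (K : nat) : finType :=
  ('I_K + {e : 'I_K * 'I_K | (e.1 < e.2)%N} + 'I_K)%type.

Definition rate (R : realType) (K : nat) (d v b : R) (c : clock K) : R :=
  match c with
  | inl (inl _) => d
  | inl (inr _) => v
  | inr _ => b
  end.

Definition update (R : realType) (m K : nat) (w0 wc : R) (pay : payoffs R)
    (c : clock K) (u : R) (s : config R m K) : config R m K :=
  match c with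
  | inl (inl i) => do_move i u s
  | inl (inr e) => do_game pay (val e).1 (val e).2 u s
  | inr i => do_birth w0 wc i u s
  end.

Definition mutually_independent (disp : measure_display)
    (Omega : measurableType disp) (R : realType) (P : probability Omega R)
    (I : eqType) (F : I -> set (set Omega)) : Prop :=
  forall (J : seq I) (A : I -> set Omega), uniq J ->
    (forall i, i \in J -> F i (A i)) ->
    P (\bigcap_(i in [set` J]) A i) = (\prod_(i <- J) P (A i))%E.

(* The sigma-algebra generated by a real random variable. *)
Definition sigma_var (R : realType) (Omega : Type) (U : Omega -> R) :
    set (set Omega) :=
  preimage_set_system setT U measurable.

(* The sigma-algebra generated by the counting process (N t)_{t >= 0}. *)
Definition sigma_process (R : realType) (Omega : Type)
    (N : R -> Omega -> nat) : set (set Omega) :=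
  <<s [set A | exists (t : R) (B : set nat), 0 <= t /\ A = N t @^-1` B] >>.

Definition poisson_process (disp : measure_display)
    (Omega : measurableType disp) (R : realType) (P : probability Omega R)
    (lambda : R) (N : R -> Omega -> nat) : Prop :=
  [/\ forall t : R, 0 <= t -> measurable_fun setT (N t),
      forall omega, N 0 omega = 0%N,
      (forall omega (s t : R), 0 <= s -> s <= t -> (N s omega <= N t omega)%N) /\
      (forall omega (t : R), 0 <= t -> \forall s \near t^'+, N s omega = N t omega),
      forall (s t : R) k, 0 <= s -> s < t ->
        P [set omega | (N t omega - N s omega)%N = k] =
        (poisson_pmf (lambda * (t - s)) k)%:E
    & forall t : nat -> R, 0 <= t 0%N -> {homo t : i j / (i <= j)%N >-> i <= j} ->
        mutually_independent P (fun k : nat =>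
          preimage_set_system setT
            (fun omega => (N (t k.+1) omega - N (t k) omega)%N)
            (@setT (set nat)))].

(* [st] is a Demographic Prisoner's Dilemma process started from [s0], driven
   by independent Poisson processes [N c] and uniform variables [U c n], the
   latter being used at the (n+1)-st ring of the clock c. The last two clauses
   say that [st] is constant while no clock rings and is updated when one does.
   They determine the path as long as no two clocks ring simultaneously, which
   holds almost surely. *)
Definition DPD_process (R : realType) (m K : nat) (d v b w0 wc : R)
    (pay : payoffs R) (s0 : config R m K) (disp : measure_display)
    (Omega : measurableType disp) (P : probability Omega R)
    (st : R -> Omega -> config R m K) : Prop :=
  exists (N : clock K -> R -> Omega -> nat)
         (U : clock K -> nat -> {RV P >-> R}),
  [/\ (forall c, poisson_process P (rate d v b c) (N c)) /\
      (forall c n B, measurable B ->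
         distribution P (U c n) B = uniform_prob (@ltr01 R) B),
      mutually_independent P (fun a : clock K + clock K * nat =>
        match a with
        | inl c => sigma_process (N c)
        | inr (c, n) => sigma_var (U c n)
        end),
      (forall (t : R) i, 0 <= t ->
        [/\ forall x, measurable [set omega | position (st t omega i) = x],
            measurable_fun setT (fun omega => wealth (st t omega i))
          & forall z, measurable [set omega | strat (st t omega i) = z]]) /\
      (forall omega, st 0 omega = s0),
      forall omega (s t : R), 0 <= s -> s <= t ->
        (forall c, N c t omega = N c s omega) -> st t omega = st s omega
    & forall omega (s t : R) c, 0 <= s -> s <= t ->
        N c t omega = (N c s omega).+1 ->
        (forall c', c' != c -> N c' t omega = N c' s omega) ->
        st t omega = update w0 wc pay c (U c (N c s omega) omega) (st s omega)].

Definition survival (R : realType) (m K : nat) (s0 : config R m K)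
    (Omega : Type) (st : R -> Omega -> config R m K) : set Omega :=
  [set omega | forall (t : R) i, 0 <= t -> alive (s0 i) -> 0 < wealth (st t omega i)].

(* Main.v *)
Require Import Defs.
From mathcomp Require Import measurable_realfun ring lra.

Set Implicit Arguments.
Unset Strict Implicit.
Unset Printing Implicit Defensive.

Local Open Scope classical_set_scope.
Local Open Scope ring_scope.

(* Call A the set of initially alive particles and fix a cooperator i0 in A.
   Cut time into windows of H unit intervals. A window is perfect if exactly one
   clock rings in each of its unit intervals, in an order prescribed once and
   for all: i0 travels through the whole torus once for each other member j of
   A, first the cooperators and then the defectors, and the game clock of
   {i0, j} rings at each site. Whatever the positions, i0 then plays with
   everybody; if R > S H nobody in A dies in a perfect window, in which the
   cooperators gain at least R - S H and the defectors at least T. In any other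
   window a particle loses at most S (or 2P) per ring, and births cost at most
   K w0 altogether since each of them uses up an unborn particle. So A survives
   if, before each imperfect window, the number of rings up to the end of that
   window, plus K, is at most nu times the number of perfect windows so far.
   Windows are i.i.d., are perfect with positive probability, and have numbers
   of rings with exponential moments. If the first n0 windows are perfect, a
   Chernoff bound makes the failure of this condition at a later time unlikely
   once n0 and nu are large, with nu depending only on the law of the clocks. *)

(** * Rewards along an i.i.d. sequence *)

(** The constants may depend neither on the payoffs nor on the initial configuration, so the
    favourable event is described by the clocks and directions alone, and the payoffs enter only in
    a deterministic argument along each path of that event. Prescribing one ring per unit interval
    lets perfection be read from the counts at integer times: independent Poisson increments suffice
    and ring times never appear. Only [i0] moves in a perfect window, so only its directions have to
    be recorded. Cooperators come first because [i0] may start with arbitrarily little wealth: it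
    earns at least R among them, which pays for at most H losses of S to the defectors. Independence
    of the windows is used only through the probabilities of finite initial words, whose product
    form makes the Chernoff bound an induction on words. The path clauses of the process are silent
    about simultaneous rings, so a null set has to be removed before they can be iterated. *)

Section iid_words.
Context (R : realType) (disp : measure_display) (Omega : measurableType disp)
  (P : probability Omega R) (X : nat -> Omega -> nat) (q : nat -> R).
Hypothesis measurable_X : forall n s, measurable [set omega | X n omega = s].
Hypothesis q_ge0 : forall s, 0 <= q s.
Hypothesis iid_X : forall w : seq nat,
  P [set omega | mkseq (X^~ omega) (size w) = w] = (\prod_(s <- w) q s)%:E.

Lemma measurable_comp_discrete n (A : set nat) :
  measurable [set omega | A (X n omega)].
Proof.
have -> : [set omega | A (X n omega)] =
    \bigcup_(s in A) [set omega | X n omega = s].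
  by apply/seteqP; split=> [omega /= AX|omega [s As /= ->]//]; exists (X n omega).
by apply: bigcup_measurable => s _.
Qed.

Lemma measurable_nat_discrete n : measurable_fun setT (X n).
Proof.
by move=> _ A _; rewrite setTI; exact: measurable_comp_discrete.
Qed.

Lemma measurable_real_discrete (f : nat -> R) n :
  measurable_fun setT (fun omega => f (X n omega)).
Proof.
apply: (@measurableT_comp _ _ _ _ _ _ f _ (X n)) => //.
exact: measurable_nat_discrete.
Qed.

Lemma measurable_word (w : seq nat) :
  measurable [set omega | mkseq (X^~ omega) (size w) = w].
Proof.
have -> : [set omega | mkseq (X^~ omega) (size w) = w] =
    \bigcap_(k in `I_(size w)) [set omega | X k omega = nth 0%N w k].
  apply/seteqP; split=> omega /=.
    by move=> <- k; rewrite /= size_mkseq => kw; rewrite nth_mkseq.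
  move=> Xw; apply: (@eq_from_nth _ 0%N); rewrite size_mkseq// => k kw.
  by rewrite nth_mkseq//; exact: Xw.
by apply: bigcap_measurableType => k _.
Qed.

Lemma measurable_sum_ge (phi : nat -> R) (a : R) k n :
  measurable [set omega | a <= \sum_(j < n) phi (X (k + j)%N omega)].
Proof.
have mS : measurable_fun setT (fun omega => \sum_(j < n) phi (X (k + j)%N omega)).
  by apply: measurable_sum => j; exact: measurable_real_discrete.
have -> : [set omega | a <= \sum_(j < n) phi (X (k + j)%N omega)] =
   (fun omega => \sum_(j < n) phi (X (k + j)%N omega)) @^-1` `[a, +oo[.
  by apply/seteqP; split=> omega /=; rewrite in_itv /= andbT.
by rewrite -[_ @^-1` _]setTI; exact: mS.
Qed.

(* Chernoff bound, conditionally on a finite past [w]. *)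
Lemma iid_sum_tail (phi : nat -> R) (theta rho : R) : 0 <= theta ->
  (\sum_(s <oo) (q s * expR (theta * phi s))%:E <= rho%:E)%E ->
  forall n (w : seq nat) (a : R),
  (P ([set omega | mkseq (X^~ omega) (size w) = w] `&`
      [set omega | (a <= \sum_(j < n) phi (X (size w + j)%N omega))%R])
   <= ((\prod_(s <- w) q s) * expR (- (theta * a)) * rho ^+ n)%:E)%E.
Proof.
move=> theta0 qrho; have pi0 w : 0 <= \prod_(s <- w) q s by apply: prodr_ge0.
have rho0 : 0 <= rho.
  rewrite -lee_fin; apply: le_trans qrho; apply: nneseries_ge0 => s _ _.
  by rewrite lee_fin mulr_ge0// expR_ge0.
elim=> [|n IHn] w a.
  have [a0|a0] := leP a 0.
    apply: (@le_trans _ _ (P [set omega | mkseq (X^~ omega) (size w) = w])).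
      by apply: measureIl; [exact: measurable_word|exact: measurable_sum_ge].
    rewrite iid_X lee_fin expr0 mulr1 ler_peMr// -expR0 ler_expR.
    by rewrite oppr_ge0 mulr_ge0_le0.
  rewrite (_ : _ `&` _ = set0).
    by rewrite measure0 lee_fin !mulr_ge0// ?expR_ge0// exprn_ge0.
  by apply/seteqP; split=> [omega [_ /=]|//]; rewrite big_ord0 leNgt a0.
(* Condition on the next symbol s: it joins the past and lowers the threshold by [phi s]. Summing
   the inductive bounds over s produces one more factor [rho]. *)
pose B s := [set omega | mkseq (X^~ omega) (size (rcons w s)) = rcons w s] `&`
   [set omega | (a - phi s <= \sum_(j < n) phi (X (size (rcons w s) + j)%N omega))%R].
have BE : [set omega | mkseq (X^~ omega) (size w) = w] `&`
   [set omega | (a <= \sum_(j < n.+1) phi (X (size w + j)%N omega))%R] =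
   \bigcup_s B s.
  have split_sum omega : \sum_(j < n.+1) phi (X (size w + j)%N omega) =
     phi (X (size w) omega) + \sum_(j < n) phi (X (size w + 1 + j)%N omega).
    rewrite big_ord_recl addn0; congr (_ + _); apply: eq_bigr => j _.
    by rewrite /bump /= addnA.
  apply/seteqP; split=> omega.
    move=> [/= Xw aS]; exists (X (size w) omega) => //; split => /=.
      by rewrite size_rcons mkseqS Xw.
    by rewrite size_rcons -addn1 lerBlDl -split_sum.
  move=> [s _ [/=]]; rewrite size_rcons mkseqS => /rcons_inj[Xw <-].
  by rewrite -addn1 lerBlDl -split_sum.
have mB s : measurable (B s).
  by apply: measurableI; [exact: measurable_word|exact: measurable_sum_ge].
rewrite BE measure_semi_bigcup//; last 2 first.
- apply/trivIsetP => s t _ _ st; apply/seteqP; split=> // omega [[/= + _] [/= + _]].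
  rewrite !size_rcons !mkseqS => /rcons_inj[_ Xs] /rcons_inj[_ Xt].
  by rewrite -Xs -Xt eqxx in st.
- exact: bigcupT_measurable.
set c := (\prod_(s <- w) q s) * expR (- (theta * a)) * rho ^+ n.
have c0 : 0 <= c by rewrite !mulr_ge0// ?expR_ge0// exprn_ge0.
apply: (@le_trans _ _ (\sum_(s <oo) (c%:E * (q s * expR (theta * phi s))%:E))%E).
  apply: lee_nneseries => // s _; apply: (le_trans (IHn (rcons w s) (a - phi s))).
  rewrite big_rcons /= -EFinM lee_fin /c mulrBr opprB expRD.
  by rewrite le_eqVlt; apply/orP; left; apply/eqP; ring.
rewrite nneseriesZl; last by move=> s _; rewrite lee_fin mulr_ge0// expR_ge0.
rewrite exprSr mulrA -/c [leRHS]EFinM; apply: lee_wpmul2l => //.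
Qed.



(** Replacing the exponent [ell g] of g by [- kappa] lowers the contribution of g from at least
    [q g] to at most [q g / 2], while the original series exceeds 1 by less than [q g / 2]. Hence
    the tilted series falls below 1. *)
Lemma iid_tilted_lt1 (g : nat) (ell : nat -> nat) (theta kappa : R) :
  0 < q g -> 0 <= theta -> expR (- (theta * kappa)) <= 2^-1 ->
  (\sum_(s <oo) (q s * expR (theta * (ell s)%:R))%:E < (1 + q g / 2)%:E)%E ->
  exists2 rho : R, 0 <= rho < 1 &
  (\sum_(s <oo) (q s * expR (theta *
     ((ell s)%:R - ((ell g)%:R + kappa) * (s == g)%:R)))%:E <= rho%:E)%E.
Proof.
move=> qg theta0 kappa_ge.
have term_ge0 (x : R) s : (0 <= (q s * expR x)%:E)%E.
  by rewrite lee_fin mulr_ge0// expR_ge0.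
rewrite (@nneseriesD1 _ _ g)// => S_lt.
rewrite (@nneseriesD1 _ _ g)//= eqxx mulr1 opprD addrA subrr sub0r mulrN.
move: S_lt.
set S' := limn _; set S := limn _.
have -> : S = S'.
  by apply: eq_eseriesr => s /= sg; rewrite (negbTE sg) mulr0 subr0.
have S'0 : (0 <= S')%E by apply: nneseries_ge0 => s _ _; exact: term_ge0.
case: S' S'0 => [r r0|//|//].
  rewrite -!EFinD lte_fin => rlt.
  have e1 : 1 <= expR (theta * (ell g)%:R) by rewrite -expR0 ler_expR mulr_ge0.
  exists (q g * expR (- (theta * kappa)) + r) => //.
  rewrite lee_fin in r0.
  rewrite addr_ge0 ?mulr_ge0 ?expR_ge0//=.
  by nra.
Qed.

(* A long initial run of g has positive probability, and gives a credit which
   makes a later failure unlikely by [iid_sum_tail]. *)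
Lemma iid_reward_dominates (g : nat) (ell : nat -> nat) (theta kappa : R) (B : nat) :
  0 < q g -> 0 < theta -> 0 <= kappa -> expR (- (theta * kappa)) <= 2^-1 ->
  (\sum_(s <oo) (q s * expR (theta * (ell s)%:R))%:E < (1 + q g / 2)%:E)%E ->
  exists G : set Omega, [/\ measurable G, (0 < P G)%E &
    forall omega, G omega -> forall n, X n omega = g \/
      (\sum_(k < n.+1) ell (X k omega) + B)%N%:R <=
      (2 * (ell g)%:R + 1 + B%:R + kappa) * (\sum_(k < n) (X k omega == g))%N%:R].
Proof.
move=> qg theta0 kappa0 kappa_ge qlt.
have [rho /andP[rho0 rho1] phi_le] := iid_tilted_lt1 qg (ltW theta0) kappa_ge qlt.
set phi := fun s : nat => ((ell s)%:R - ((ell g)%:R + kappa) * (s == g)%:R : R).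
(* The later failures sum to a geometric series of ratio [rho], and this product bounds their
   probability relative to that of the initial run. As e^x >= 1 + x, any n0 above 1 / (theta (1 -
   rho)) will do. *)
have [n0 n00 n0_gt] : exists2 n0 : nat, (0 < n0)%N & (1 - rho)^-1 * expR (- (theta * n0%:R)) < 1.
  have t0 : 0 <= (theta * (1 - rho))^-1.
    by rewrite invr_ge0 mulr_ge0 ?subr_ge0 ?(ltW theta0)// ltW.
  exists (Num.truncn (theta * (1 - rho))^-1).+1 => //.
  have := truncnS_gt (theta * (1 - rho))^-1.
  set n := (Num.truncn _).+1 => ngt.
  rewrite mulrC ltr_pdivrMr ?subr_gt0// mul1r expRN.
  rewrite invf_plt ?posrE ?expR_gt0 ?subr_gt0//.
  apply: (@lt_le_trans _ _ (1 + theta * n%:R)); last exact: expR_ge1Dx.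
  have -> : (1 - rho)^-1 = theta * (theta * (1 - rho))^-1.
    by rewrite invfM mulrA mulfV ?mul1r// gt_eqF.
  by rewrite ltr_wpDl// ltr_pM2l.
pose w := nseq n0 g.
have prod_w : \prod_(s <- w) q s = q g ^+ n0 by rewrite big_nseq iter_mulr_1.
have Pw : P [set omega | mkseq (X^~ omega) (size w) = w] = (q g ^+ n0)%:E.
  by rewrite iid_X prod_w.
(* The run of n0 symbols g is a credit of n0; [bad n] says that the n + 1 symbols after it use up
   this credit. *)
pose bad n := [set omega | mkseq (X^~ omega) (size w) = w] `&`
  [set omega | (n0%:R <= \sum_(j < n.+1) phi (X (size w + j)%N omega))%R].
have mbad n : measurable (bad n).
  by apply: measurableI; [exact: measurable_word|exact: measurable_sum_ge].
pose W := [set omega | mkseq (X^~ omega) (size w) = w].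
have mW : measurable W by exact: measurable_word.
have mU : measurable (\bigcup_n bad n) by exact: bigcupT_measurable.
have qn0 : 0 < q g ^+ n0 by rewrite exprn_gt0.
have Pbad : (P (\bigcup_n bad n) < (q g ^+ n0)%:E)%E.
  apply: (@le_lt_trans _ _ (q g ^+ n0 * ((1 - rho)^-1 * expR (- (theta * n0%:R))))%:E); last first.
    by rewrite lte_fin gtr_pMr.
  apply: (le_trans (measure_sigma_subadditive P mbad mU (@subset_refl _ _))).
  apply: lime_le; first by apply: is_cvg_nneseries => n _ _.
  apply: nearW => n.
  apply: (@le_trans _ _ (\sum_(0 <= i < n)
     (q g ^+ n0 * expR (- (theta * n0%:R)) * rho ^+ i.+1)%:E)%E).
    apply: lee_sum => i _.
    have := @iid_sum_tail phi theta rho (ltW theta0) phi_le i.+1 w n0%:R.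
    by rewrite prod_w.
  rewrite sumEFin lee_fin -mulr_sumr -mulrA ler_pM2l// [leRHS]mulrC.
  rewrite ler_wpM2l ?expR_ge0//.
  rewrite -[_^-1]mul1r ler_pdivlMr ?subr_gt0// mulrC big_mkord.
  under eq_bigr do rewrite exprS.
  rewrite -mulr_sumr; have e := subrX1 rho n.
  have -> : (1 - rho) * (rho * \sum_(i < n) rho ^+ i) = rho * (1 - rho ^+ n).
    by rewrite -[1 - rho ^+ n]opprB e; ring.
  have rn : 0 <= rho ^+ n by rewrite exprn_ge0.
  by nra.
exists (W `\` \bigcup_n bad n); split.
- exact: measurableD.
- have e : (q g ^+ n0)%:E = (P (W `\` \bigcup_n bad n) + P (W `&` \bigcup_n bad n))%E.
    by rewrite -Pw; exact: measureDI.
    rewrite lt0e measure_ge0 andbT; apply/eqP => e0; rewrite e0 add0e in e.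
  have : (P (W `&` \bigcup_n bad n) <= P (\bigcup_n bad n))%E by exact: measureIr.
  by rewrite -e leNgt Pbad.
move=> omega [/= Xw notbad] n.
have Xg k : (k < n0)%N -> X k omega = g.
  move=> kn; have := congr1 (fun s => nth 0%N s k) Xw.
  by rewrite /= size_nseq nth_mkseq// nth_nseq kn.
have [nn0|n0n] := ltnP n n0; first by left; exact: Xg.
have [Xng|Xng] := eqVneq (X n omega) g; [by left|right].
rewrite -(subnKC n0n) in Xng *; move: (n - n0)%N Xng => k Xng.
have : ~ bad k omega by move=> badk; apply: notbad; exists k.
rewrite /bad /= => /not_andP[//|/negP]; rewrite -ltNge.
rewrite -addnS !big_split_ord /=.
under [X in _ -> (X + _ + _)%N%:R <= _]eq_bigr do rewrite Xg//.
under [X in _ -> _ <= _ * (X + _)%N%:R]eq_bigr do rewrite Xg// eqxx.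
rewrite !sum_nat_const !card_ord muln1 size_nseq.
(* Because [X n] differs from g, the count of g over the first n symbols already includes all those
   up to n. This is why the conclusion may count the past only. *)
rewrite sumrB -mulr_sumr -!natr_sum [X in _ - _ * X%:R < _]big_ord_recr /= (negbTE Xng) addn0.
set L := (\sum_(i < k.+1) _)%N; set V := (\sum_(i < k) _)%N => lt_n0.
rewrite !natrD natrM.
have n0R : 1 <= n0%:R :> R by rewrite ler1n.
have V0 : 0 <= V%:R :> R by [].
have B0 : 0 <= B%:R :> R by [].
have g0 : 0 <= (ell g)%:R :> R by [].
by nra.
Qed.

End iid_words.

(** * Unit intervals of the driving processes *)

Lemma mkseq_eq_bigcap (Omega T : Type) (x0 : T) (Y : nat -> Omega -> T) (w : seq T) :
  [set omega | mkseq (Y^~ omega) (size w) = w] =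
  \bigcap_(k in [set` iota 0 (size w)]) [set omega | Y k omega = nth x0 w k].
Proof.
apply/seteqP; split=> omega /=.
  by move=> <- k; rewrite /= mem_iota add0n size_mkseq => kw; rewrite nth_mkseq.
move=> Yw; apply: (@eq_from_nth _ x0); rewrite size_mkseq// => k kw.
by rewrite nth_mkseq//; apply: Yw; rewrite /= mem_iota.
Qed.

Lemma mkseqD (T : Type) (f : nat -> T) m n :
  mkseq f (m + n) = mkseq f m ++ mkseq (fun k => f (m + k)%N) n.
Proof. by rewrite /mkseq iotaD map_cat add0n -[in iota m n](addn0 m) iotaDl -map_comp. Qed.

Lemma measurable_mkseq (disp : measure_display) (Omega : measurableType disp)
    (T : Type) (Y : nat -> Omega -> T) (w : seq T) :
  (forall k s, measurable [set omega | Y k omega = s]) ->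
  measurable [set omega | mkseq (Y^~ omega) (size w) = w].
Proof.
move=> mY; case: w => [|x0 w].
  by rewrite (_ : [set _ | _] = setT)//; apply/seteqP; split.
by rewrite (mkseq_eq_bigcap x0); apply: fin_bigcap_measurable.
Qed.

Definition unit_rings (R : realType) (Omega : Type) (N : R -> Omega -> nat)
    (k : nat) (omega : Omega) : nat :=
  (N k.+1%:R omega - N k%:R omega)%N.

Lemma measurable_unit_rings (R : realType) (disp : measure_display)
    (Omega : measurableType disp) (N : R -> Omega -> nat) (k n : nat) :
  (forall t, 0 <= t -> measurable_fun setT (N t)) ->
  measurable [set omega | unit_rings N k omega = n].
Proof.
move=> mN; have mI : measurable_fun setT (unit_rings N k).
  by apply: measurable_realfun.measurable_fun_subn; exact: mN.
have -> : [set omega | unit_rings N k omega = n] = unit_rings N k @^-1` [set n].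
  by apply/seteqP; split.
by rewrite -[_ @^-1` _]setTI; exact: mI.
Qed.


Lemma measurable_word_unit_rings (R : realType) (disp : measure_display)
    (Omega : measurableType disp) (N : R -> Omega -> nat) (l : seq nat) :
  (forall t, 0 <= t -> measurable_fun setT (N t)) ->
  measurable [set omega | mkseq ((unit_rings N)^~ omega) (size l) = l].
Proof.
by move=> mN; apply: measurable_mkseq => k s; exact: measurable_unit_rings.
Qed.

(** Here [Omega] carries the sigma-algebra generated by N. A measurability lemma valid on every
    measurable space then yields membership in [sigma_process N]. *)
Lemma measurable_fun_sigma_process (R : realType) (disp : measure_display)
    (Omega : measurableType disp) (N : R -> Omega -> nat) (t : R) : 0 <= t ->
  measurable_fun setT (N t : g_sigma_algebraType
    [set A | exists (t : R) (B : set nat), 0 <= t /\ A = N t @^-1` B] -> nat).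
Proof.
by move=> t0 _ B _; rewrite setTI; apply: sub_sigma_algebra; exists t, B.
Qed.

Lemma sigma_process_word (R : realType) (disp : measure_display)
    (Omega : measurableType disp) (N : R -> Omega -> nat) (l : seq nat) :
  sigma_process N [set omega | mkseq ((unit_rings N)^~ omega) (size l) = l].
Proof.
exact: (measurable_word_unit_rings l (@measurable_fun_sigma_process R disp Omega N)).
Qed.

Lemma poisson_word (R : realType) (disp : measure_display)
    (Omega : measurableType disp) (P : probability Omega R) (lambda : R)
    (N : R -> Omega -> nat) (l : seq nat) :
  poisson_process P lambda N ->
  P [set omega | mkseq ((unit_rings N)^~ omega) (size l) = l] =
  (\prod_(n <- l) poisson_pmf lambda n)%:E.
Proof.
move=> [_ _ _ lawN indN]; rewrite (mkseq_eq_bigcap 0%N).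
rewrite (indN (fun k => k%:R))//; last 3 first.
- by move=> i j; rewrite ler_nat.
- exact: iota_uniq.
- move=> k _; exists [set nth 0%N l k] => //; rewrite setTI.
  by apply/seteqP; split.
rewrite [in RHS](big_nth 0%N) /index_iota subn0 -prodEFin; apply: eq_bigr => k _.
by rewrite lawN ?ltr_nat// -natrB// subSnn mulr1.
Qed.

Section unit_symbols.
Context (R : realType) (C : finType) (rate : C -> R) (disp : measure_display)
  (Omega : measurableType disp) (P : probability Omega R)
  (N : C -> R -> Omega -> nat) (U : C -> nat -> {RV P >-> R}) (c0 : C).
Hypothesis rate_gt0 : forall c, 0 < rate c.
Hypothesis poisson_N : forall c, poisson_process P (rate c) (N c).
Hypothesis uniform_U : forall c n B, measurable B ->
  distribution P (U c n) B = uniform_prob (@ltr01 R) B.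
Hypothesis indep : mutually_independent P (fun a : C + C * nat =>
  match a with
  | inl c => sigma_process (N c)
  | inr (c, n) => sigma_var (U c n)
  end).

Local Notation symbol := ({ffun C -> nat} * seq nat)%type.

(** The index that [choose] looks up in the list of four neighbours. As a function on all reals it
    is 0 also for negative u, and it reaches 4 at u = 1. *)
Definition direction (u : R) : nat := Num.truncn (u * 4).

Definition direction_prob (n : nat) : R :=
  fine (uniform_prob (@ltr01 R) [set u | direction u = n]).

(* Recording the directions next to the numbers of rings makes the symbols
   i.i.d., although the index of the first direction used is random. *)
Definition unit_symbol (k : nat) (omega : Omega) : symbol :=
  ([ffun c => unit_rings (N c) k omega],
   mkseq (fun r => direction (U c0 (N c0 k%:R omega + r)%N omega))
     (unit_rings (N c0) k omega)).

(** A unit interval shows exactly as many directions as [c0] has rings, so every other pair gets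
    weight 0. *)
Definition symbol_prob (s : symbol) : R :=
  if size s.2 == s.1 c0 then
    (\prod_c poisson_pmf (rate c) (s.1 c)) * \prod_(n <- s.2) direction_prob n
  else 0.

Lemma measurable_direction n : measurable [set u : R | direction u = n].
Proof.
case: n => [|n].
  have -> : [set u : R | direction u = 0%N] = `]-oo, 4^-1[%classic.
    apply/seteqP; split=> u /=; rewrite in_itv /= /direction.
      move/(truncn0Pn _) => h; move: h; rewrite -ltNge; lra.
    by move=> h; apply/truncn0Pn; rewrite -ltNge; lra.
  exact: measurable_itv.
have -> : [set u : R | direction u = n.+1] = `[n.+1%:R / 4, n.+2%:R / 4[%classic.
  apply/seteqP; split=> u /=; rewrite in_itv /= /direction => h.
    have u0 : 0 <= u * 4.
      rewrite leNgt; apply/negP => u0; move: h.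
      by have /truncn0Pn -> : ~~ (1 <= u * 4) by rewrite -ltNge (lt_trans u0).
    by have := truncn_itv u0; rewrite h => /andP[h1 h2]; apply/andP; split; lra.
  by apply: truncn_def; case/andP: h => h1 h2; apply/andP; split; lra.
exact: measurable_itv.
Qed.

Lemma direction_prob_ge0 n : 0 <= direction_prob n.
Proof. by rewrite fine_ge0// measure_ge0. Qed.

Lemma direction_probE c k n :
  P [set omega | direction (U c k omega) = n] = (direction_prob n)%:E.
Proof.
have /= := uniform_U c k (measurable_direction n).
rewrite /distribution /pushforward /= => ->.
by rewrite fineK// fin_num_measure//; exact: measurable_direction.
Qed.

Lemma direction_prob_gt0 n : (n < 4)%N -> 0 < direction_prob n.
Proof.
move=> n4; have mn := measurable_direction n.
apply: fine_gt0; rewrite ltey_eq fin_num_measure// andbT.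
have n0 : 0 <= n%:R :> R by [].
have n3 : n%:R <= 3 :> R by rewrite ler_nat.
apply: (@lt_le_trans _ _ (uniform_prob (@ltr01 R) `[n%:R / 4, n.+1%:R / 4[%classic)).
  rewrite /uniform_prob (eq_integral (fun=> 1%:E)).
    rewrite integral_cst//= mul1e lebesgue_measure_itv /= lte_fin.
    rewrite ifT ?ltr_pM2r ?ltr_nat ?invr_gt0//.
    by rewrite -EFinD lte_fin -natr1; lra.
  move=> x; rewrite inE /= in_itv /= -[n.+1%:R]natr1 => /andP[h1 h2].
  by rewrite /uniform_pdf ifT ?subr0 ?invr1//; apply/andP; split; lra.
apply: le_measure; rewrite ?inE//.
move=> u /=; rewrite in_itv /= => /andP[h1 h2].
by rewrite /direction; apply: truncn_def; apply/andP; split; lra.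
Qed.

Lemma symbol_prob_ge0 s : 0 <= symbol_prob s.
Proof.
rewrite /symbol_prob; case: ifP => // _; rewrite mulr_ge0// prodr_ge0// => x _.
  exact: poisson_pmf_ge0.
exact: direction_prob_ge0.
Qed.

Lemma rings_unit_rings c n omega :
  N c n%:R omega = (\sum_(k < n) unit_rings (N c) k omega)%N.
Proof.
have [_ N0 [Nmon _] _ _] := poisson_N c.
elim: n => [|n IHn]; first by rewrite big_ord0 N0.
rewrite big_ord_recr /= -IHn /unit_rings subnKC// Nmon//.
by rewrite ler_nat.
Qed.

(** Once the word w is fixed, so are the counts of [c0] at all integer times, and the random indices
    of the directions become deterministic: the word reads the first variables [U c0 0], [U c0 1],
    ... in order. The event thus splits into conditions on independent sources. *)
Lemma unit_symbol_wordE (w : seq symbol) omega :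
  (forall s, s \in w -> size s.2 = s.1 c0) ->
  mkseq (unit_symbol^~ omega) (size w) = w <->
  (forall c, mkseq ((unit_rings (N c))^~ omega) (size w) = [seq (s : symbol).1 c | s <- w]) /\
  mkseq (fun r => direction (U c0 r omega)) (size (flatten (unzip2 w))) =
    flatten (unzip2 w).
Proof.
elim/last_ind: w => [|w s IHw] wc; first by split.
have ws s' : s' \in w -> size s'.2 = s'.1 c0.
  by move=> ss; apply: wc; rewrite mem_rcons inE ss orbT.
have sc : size s.2 = s.1 c0 by apply: wc; rewrite mem_rcons inE eqxx.
(* If the counts agree with w, the index of the next unread direction is the number of directions
   listed so far. *)
have Nw : (forall c, mkseq ((unit_rings (N c))^~ omega) (size w) =
      [seq (s : symbol).1 c | s <- w]) ->
    N c0 (size w)%:R omega = size (flatten (unzip2 w)).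
  move=> /(_ c0) wE; rewrite rings_unit_rings size_flatten /shape sumnE.
  rewrite -(big_mkord xpredT (fun k => unit_rings (N c0) k omega)) /index_iota subn0.
  rewrite -(big_map (fun k => unit_rings (N c0) k omega) xpredT id) /= -/(mkseq _ _) wE.
  rewrite !big_map; apply: eq_big_seq => s' s'w; by rewrite ws.
rewrite size_rcons mkseqS /unzip2 map_rcons flatten_rcons size_cat mkseqD.
have lastE : (forall c, mkseq ((unit_rings (N c))^~ omega) (size w) =
      [seq (s : symbol).1 c | s <- w]) ->
    (forall c, unit_rings (N c) (size w) omega = s.1 c) ->
    mkseq (fun r => direction (U c0 (size (flatten (unzip2 w)) + r)%N omega))
      (size s.2) = (unit_symbol (size w) omega).2.
  by move=> w1 s1; rewrite /unit_symbol /= s1 Nw// sc.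
split.
  move=> /rcons_inj[/(IHw ws)[w1 w2] sE].
  have s1 c : unit_rings (N c) (size w) omega = s.1 c by rewrite -sE ffunE.
  split; first by move=> c; rewrite mkseqS map_rcons w1 s1.
  by rewrite -/(unzip2 w) w2 lastE// sE.
move=> [w1s w2s].
have w1 c : mkseq ((unit_rings (N c))^~ omega) (size w) = [seq (s : symbol).1 c | s <- w].
  by have := w1s c; rewrite mkseqS map_rcons => /rcons_inj[].
have s1 c : unit_rings (N c) (size w) omega = s.1 c.
  by have := w1s c; rewrite mkseqS map_rcons => /rcons_inj[].
move/eqP: w2s; rewrite eqseq_cat ?size_mkseq// -/(unzip2 w) => /andP[/eqP w2 /eqP s2].
have /(IHw ws) -> := conj w1 w2; congr (rcons _ _).
rewrite (lastE w1 s1) in s2; rewrite [LHS]surjective_pairing s2 [RHS]surjective_pairing.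
by congr (_, _); apply/ffunP => c; rewrite ffunE s1.
Qed.

Lemma unit_symbol_word (w : seq symbol) :
  P [set omega | mkseq (unit_symbol^~ omega) (size w) = w] =
  (\prod_(s <- w) symbol_prob s)%:E.
Proof.
have [wc|] := boolP (all (fun s : symbol => size s.2 == s.1 c0) w); last first.
  move=> wNc; have [s sw sNc] := allPn wNc.
  have -> : \prod_(s <- w) symbol_prob s = 0.
    apply/eqP; rewrite prodf_seq_eq0; apply/hasP; exists s => //=.
    by rewrite /symbol_prob (negbTE sNc).
  rewrite (_ : [set _ | _] = set0) ?measure0//; apply/seteqP; split=> // omega /= we.
  move: sw; rewrite -we => /mapP[k _ sE]; move: sNc.
  by rewrite sE /unit_symbol /= size_mkseq ffunE eqxx.
have {}wc s : s \in w -> size s.2 = s.1 c0 by move=> sw; apply/eqP/(allP wc).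
pose L := flatten (unzip2 w).
(* One event for each clock and one for each direction that is read; they belong to distinct members
   of the independent family. *)
pose J := [seq inl c | c <- enum C] ++ [seq inr (c0, n) | n <- iota 0 (size L)] : seq (C + C * nat).
pose A (a : C + C * nat) := match a with
  | inl c => [set omega | mkseq ((unit_rings (N c))^~ omega)
       (size [seq (s : symbol).1 c | s <- w]) = [seq (s : symbol).1 c | s <- w]]
  | inr (c, n) => [set omega | direction (U c n omega) = nth 0%N L n]
  end.
have -> : [set omega | mkseq (unit_symbol^~ omega) (size w) = w] =
    \bigcap_(a in [set` J]) A a.
  apply/seteqP; split=> omega.
    move=> /(unit_symbol_wordE _ wc)[w1 w2] a; rewrite /= mem_cat => /orP[|] /mapP.
      by move=> [c _ ->] /=; rewrite size_map w1.
    move=> [n]; rewrite mem_iota add0n => nL -> /=.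
    by have := congr1 (nth 0%N ^~ n) w2; rewrite nth_mkseq.
  move=> AJ; apply/(unit_symbol_wordE _ wc); split.
    move=> c; have := AJ (inl c); rewrite /= size_map; apply.
    by rewrite mem_cat map_f// mem_enum.
  apply: (@eq_from_nth _ 0%N); rewrite size_mkseq// => n nL.
  rewrite nth_mkseq//; apply: (AJ (inr (c0, n))).
  by rewrite /= mem_cat; apply/orP; right; rewrite map_f// mem_iota.
rewrite indep//; last 2 first.
- rewrite cat_uniq !map_inj_uniq ?enum_uniq ?iota_uniq ?andbT//=.
  + rewrite -enumT enum_uniq; apply/hasPn => _ /mapP[n _ ->] /=.
    by apply/negP => /mapP[].
  + by move=> m n [].
  + by move=> c c' [].
- move=> [c|[c n]] _ /=; first exact: sigma_process_word.
  exists [set u | direction u = nth 0%N L n]; first exact: measurable_direction.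
  by rewrite setTI; apply/seteqP; split.
rewrite big_cat !big_map -enumT big_enum /=.
under eq_bigr do rewrite (poisson_word _ (poisson_N _)) big_map.
under [X in (_ * X)%E]eq_bigr do rewrite direction_probE.
rewrite !prodEFin -EFinM; congr (_%:E).
transitivity (\prod_(s <- w) ((\prod_c poisson_pmf (rate c) (s.1 c)) *
    \prod_(n <- s.2) direction_prob n)); last first.
  rewrite big_seq [RHS]big_seq; apply: eq_bigr => s /wc.
  by rewrite /symbol_prob => ->; rewrite eqxx.
rewrite big_split /= exchange_big /=; congr (_ * _).
have <- : \prod_(n <- L) direction_prob n =
    \prod_(j <- iota 0 (size L)) direction_prob (nth 0%N L j).
  by rewrite (big_nth 0%N) /index_iota subn0.
by rewrite /L big_flatten big_map.
Qed.

Lemma measurable_unit_symbol k s : measurable [set omega | unit_symbol k omega = s].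
Proof.
have mN c t : 0 <= t -> measurable_fun setT (N c t).
  by have [mN _ _ _ _] := poisson_N c; exact: mN.
(* The index of the first direction is random, so the event is split according to its value a. *)
have -> : [set omega | unit_symbol k omega = s] =
   (\bigcap_(c in [set: C]) [set omega | unit_rings (N c) k omega = s.1 c]) `&`
   \bigcup_a ([set omega | unit_rings (N c0) k omega = size s.2] `&`
      ([set omega | N c0 k%:R omega = a] `&` [set omega | mkseq
      (fun r => direction (U c0 (a + r)%N omega)) (size s.2) = s.2])).
  apply/seteqP; split=> omega.
    move=> /= <- /=; split; first by move=> c _ /=; rewrite ffunE.
    by exists (N c0 k%:R omega); rewrite //= size_mkseq.
  move=> [/= s1 [a _ [kc [Na s2]]]]; rewrite /unit_symbol kc Na s2 [RHS]surjective_pairing.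
  by congr (_, _); apply/ffunP => c; rewrite ffunE s1.
apply: measurableI.
  by apply: fin_bigcap_measurable => // c _; apply: measurable_unit_rings; exact: mN.
apply: bigcupT_measurable => a; apply: measurableI.
  by apply: measurable_unit_rings; exact: mN.
apply: measurableI.
  rewrite (_ : [set _ | _] = N c0 k%:R @^-1` [set a]); last by apply/seteqP; split.
  by rewrite -[_ @^-1` _]setTI; exact: mN.
apply: measurable_mkseq => r n.
rewrite (_ : [set _ | _] = U c0 (a + r)%N @^-1` [set u | direction u = n]).
  by apply: measurable_funPTI; exact: measurable_direction.
by apply/seteqP; split.
Qed.
End unit_symbols.

(** * Blocks and exponential moments *)

Section blocks.
Context (R : realType) (disp : measure_display) (Omega : measurableType disp)
  (P : probability Omega R) (T : countType) (X : nat -> Omega -> T) (q : T -> R)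
  (H : nat).
Hypothesis measurable_X : forall n s, measurable [set omega | X n omega = s].
Hypothesis iid_X : forall w : seq T,
  P [set omega | mkseq (X^~ omega) (size w) = w] = (\prod_(s <- w) q s)%:E.

Definition block (n : nat) (omega : Omega) : seq T :=
  mkseq (fun r => X (n * H + r)%N omega) H.

(** The law of the coded blocks. [pickle_inv] is defined on genuine codes only, so an integer that
    codes no list of length H has weight 0. *)
Definition block_prob (k : nat) : R :=
  if pickle_inv k is Some s then
    if size s == H then \prod_(x <- s) q x else 0
  else 0.

Lemma measurable_block n k : measurable [set omega | pickle (block n omega) = k].
Proof.
case E : (pickle_inv k : option (seq T)) => [s|]; last first.
  rewrite (_ : [set _ | _] = set0)//; apply/seteqP; split=> // omega /= bk.
  by move: E; rewrite -bk pickleK_inv.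
have ks : pickle s = k by have := @pickle_invK (seq T) k; rewrite E.
have [sH|sH] := eqVneq (size s) H.
  rewrite (_ : [set _ | _] =
      [set omega | mkseq (fun r => X (n * H + r)%N omega) (size s) = s]).
    by apply: measurable_mkseq => r x.
  rewrite sH -ks; apply/seteqP; split=> omega /=; last by rewrite /block => ->.
  exact: (pcan_inj pickleK).
rewrite (_ : [set _ | _] = set0)//; apply/seteqP; split=> // omega /=.
by rewrite -ks => /(pcan_inj pickleK) bs; move: sH; rewrite -bs size_mkseq eqxx.
Qed.

Lemma mkseq_blockE (omega : Omega) (ss : seq (seq T)) :
  (forall s, s \in ss -> size s = H) ->
  mkseq (block^~ omega) (size ss) = ss <->
  mkseq (X^~ omega) (size (flatten ss)) = flatten ss.
Proof.
elim/last_ind: ss => [|ss s IHss] ssH; first by [].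
have {}IHss : mkseq (block^~ omega) (size ss) = ss <->
    mkseq (X^~ omega) (size (flatten ss)) = flatten ss.
  by apply: IHss => t tss; apply: ssH; rewrite mem_rcons inE tss orbT.
have sH : size s = H by apply: ssH; rewrite mem_rcons inE eqxx.
have fH : size (flatten ss) = (size ss * H)%N.
  rewrite size_flatten /shape sumnE big_map big_seq (eq_bigr (fun=> H)).
    by rewrite -big_seq big_const_seq count_predT iter_addn_0 mulnC.
  by move=> t tss; apply: ssH; rewrite mem_rcons inE tss orbT.
rewrite size_rcons mkseqS flatten_rcons size_cat mkseqD; split.
  by move=> /rcons_inj[/IHss -> e]; rewrite -[in RHS]e sH fH.
move/eqP; rewrite eqseq_cat ?size_mkseq// => /andP[/eqP/IHss -> /eqP e].
by rewrite /block -[in RHS]e sH fH.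
Qed.

Lemma block_word (w : seq nat) :
  P [set omega | mkseq (fun n => pickle (block n omega)) (size w) = w] =
  (\prod_(k <- w) block_prob k)%:E.
Proof.
pose good k := if (pickle_inv k : option (seq T)) is Some s then size s == H else false.
have [wg|] := boolP (all good w); last first.
  move=> wNg; have [k kw kNg] := allPn wNg.
  have -> : \prod_(k <- w) block_prob k = 0.
    apply/eqP; rewrite prodf_seq_eq0; apply/hasP; exists k => //=.
    move: kNg; rewrite /block_prob /good; case: (pickle_inv k) => //= s /negbTE ->.
    by rewrite eqxx.
  rewrite (_ : [set _ | _] = set0) ?measure0//; apply/seteqP; split=> // omega /= we.
  move: kw; rewrite -we => /mapP[n _ kE]; move: kNg.
  by rewrite /good kE pickleK_inv size_mkseq eqxx.
have [ss ssw ssH] : exists2 ss : seq (seq T), map pickle ss = w &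
    forall s, s \in ss -> size s = H.
  elim: w wg => [_|k w IHw /= /andP[kg /IHw[ss ssw ssH]]]; first by exists [::].
  move: kg; rewrite /good; case E : (pickle_inv k) => [s|//] /eqP sH.
  exists (s :: ss); last by move=> t; rewrite inE => /orP[/eqP ->|/ssH].
  by rewrite /= ssw; have := @pickle_invK (seq T) k; rewrite E /= => ->.
rewrite -ssw big_map size_map.
have -> : [set omega | mkseq (fun n => pickle (block n omega)) (size ss) =
    [seq pickle s | s <- ss]] =
    [set omega | mkseq (X^~ omega) (size (flatten ss)) = flatten ss].
  apply/seteqP; split=> omega /=.
    move=> e; apply/(mkseq_blockE _ ssH); apply: (inj_map (pcan_inj pickleK)).
    by rewrite -map_comp.
  by move=> /(mkseq_blockE _ ssH) e; rewrite -[in RHS]e -map_comp.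
rewrite iid_X big_flatten /=; congr (_%:E).
rewrite big_seq [RHS]big_seq; apply: eq_bigr => s /ssH sH.
by rewrite /block_prob pickleK_inv sH eqxx.
Qed.

End blocks.

Lemma poisson_pmf_sum (R : realType) (lambda : R) : 0 < lambda ->
  (\sum_(k <oo) (poisson_pmf lambda k)%:E = 1)%E.
Proof.
move=> lambda0; have := probability_setT (poisson_prob lambda 0).
rewrite /= /poisson_prob lambda0 => <-; rewrite -nneseries_esumT//.
by move=> *; rewrite lee_fin poisson_pmf_ge0.
Qed.

Lemma poisson_exp_moment (R : realType) (lambda t : R) : 0 < lambda ->
  (\sum_(k <oo) (expR (t * k%:R) * poisson_pmf lambda k)%:E =
   (expR (lambda * (expR t - 1)))%:E)%E.
Proof.
move=> lambda0; have lt0 : 0 < lambda * expR t by rewrite mulr_gt0 ?expR_gt0.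
under eq_eseriesr => k _.
  (* Exponential tilting turns the Poisson law of parameter lambda into a multiple of that of
     parameter lambda e^t. *)
  have -> : expR (t * k%:R) * poisson_pmf lambda k =
      expR (lambda * (expR t - 1)) * poisson_pmf (lambda * expR t) k.
    rewrite /poisson_pmf lambda0 lt0 exprMn [t * _]mulrC expRM_natl.
    have -> : expR (- lambda) = expR (lambda * (expR t - 1)) * expR (- (lambda * expR t)).
      by rewrite -expRD; congr expR; ring.
    by ring.
  rewrite EFinM; over.
rewrite nneseriesZl ?poisson_pmf_sum ?mule1// => k _.
by rewrite lee_fin poisson_pmf_ge0.
Qed.

Lemma expectation_discrete (R : realType) (disp : measure_display)
    (Omega : measurableType disp) (P : probability Omega R) (X : Omega -> nat)
    (f : nat -> R) :
  (forall n, measurable [set omega | X omega = n]) -> (forall n, 0 <= f n) ->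
  (\int[P]_omega (f (X omega))%:E = \sum_(n <oo) (f n)%:E * P [set omega | X omega = n])%E.
Proof.
move=> mX f0.
have UX : \bigcup_n [set omega | X omega = n] = setT.
  by apply/seteqP; split=> // omega _; exists (X omega).
rewrite -UX ge0_integral_bigcup//=.
- apply: eq_eseriesr => n _; rewrite (eq_integral (fun=> (f n)%:E)).
    by rewrite integral_cst.
  by move=> omega; rewrite inE /= => ->.
- rewrite UX; apply/measurable_EFinP.
  exact: (@measurable_real_discrete _ _ _ (fun=> X) (fun=> mX) f 0%N).
- by move=> omega _; rewrite lee_fin.
- apply/trivIsetP => m n _ _ mn; apply/seteqP; split=> // omega /= [Xm Xn].
  by move: mn; rewrite -Xm -Xn eqxx.
Qed.

(* The exponential of the sum is at most the largest term on the right, and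
   the other terms are at least 1. *)
Lemma expR_sum_le (R : realType) (I : finType) (x : I -> R) : (forall i, 0 <= x i) ->
  expR (\sum_i x i) + #|I|%:R <= 1 + \sum_i expR (#|I|%:R * x i).
Proof.
move=> x0.
have e1 i : 1 <= expR (#|I|%:R * x i) by rewrite -expR0 ler_expR mulr_ge0.
have [I0|/card_gt0P[i0 _]] := posnP #|I|.
  have noI (i : I) : xpredT i = false by have := fintype0 i; rewrite I0.
  by rewrite I0 !(big_pred0 _ _ _ _ noI) expR0.
have [i _ imax] := @arg_maxP _ _ _ i0 xpredT x isT.
have xle : \sum_j x j <= #|I|%:R * x i.
  rewrite mulr_natl -sumr_const; apply: ler_sum => j _; exact: imax.
rewrite [X in _ <= _ + X](bigD1 i)//= addrCA lerD// ?ler_expR//.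
rewrite [leLHS](_ : _ = 1 + \sum_(j | j != i) 1); last first.
  by rewrite -sumr_const (bigD1 i).
by rewrite lerD2l; apply: ler_sum => j _; exact: e1.
Qed.

Lemma small_exponent (R : realType) (lambda p : R) (n : nat) :
  0 < lambda -> 0 < p -> (0 < n)%N -> exists2 theta : R, 0 < theta &
    n%:R * (expR (lambda * (expR (n%:R * theta) - 1)) - 1) < p.
Proof.
move=> l0 p0 n0; have nR0 : 0 < n%:R :> R by rewrite ltr0n.
have pn0 : 0 < p / (2 * n%:R) by rewrite divr_gt0 ?mulr_gt0.
set y := ln (1 + p / (2 * n%:R)).
have y0 : 0 < y by rewrite ln_gt0 ?ltrDl.
have yl : 0 < y / lambda by rewrite divr_gt0.
(* This solves the equation in which the left-hand side equals p / 2. *)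
exists (ln (1 + y / lambda) / n%:R); first by rewrite divr_gt0// ln_gt0 ?ltrDl.
rewrite mulrCA mulfV ?gt_eqF// mulr1 lnK ?posrE ?addr_gt0//.
rewrite addrAC subrr add0r mulrCA mulfV ?gt_eqF// mulr1 /y lnK ?posrE ?addr_gt0//.
rewrite addrAC subrr add0r.
have -> : n%:R * (p / (2 * n%:R)) = p / 2 :> R by field; rewrite gt_eqF.
by rewrite ltr_pdivrMr//; lra.
Qed.

(** * Windows *)

Section windows.
Context (R : realType) (C : finType) (rate : C -> R) (disp : measure_display)
  (Omega : measurableType disp) (P : probability Omega R)
  (N : C -> R -> Omega -> nat) (U : C -> nat -> {RV P >-> R}) (c0 : C).
Hypothesis rate_gt0 : forall c, 0 < rate c.
Hypothesis poisson_N : forall c, poisson_process P (rate c) (N c).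
Hypothesis uniform_U : forall c n B, measurable B ->
  distribution P (U c n) B = uniform_prob (@ltr01 R) B.
Hypothesis indep : mutually_independent P (fun a : C + C * nat =>
  match a with
  | inl c => sigma_process (N c)
  | inr (c, n) => sigma_var (U c n)
  end).

Local Notation symbol := ({ffun C -> nat} * seq nat)%type.

Definition window (H n : nat) (omega : Omega) : seq symbol :=
  block (unit_symbol N U c0) H n omega.

Definition code_rings (k : nat) : nat :=
  if (pickle_inv k : option (seq symbol)) is Some s then
    (\sum_(x <- s) \sum_c (x : symbol).1 c)%N
  else 0%N.

Lemma code_rings_window H n omega :
  code_rings (pickle (window H n omega)) =
  (\sum_(r < H) \sum_c unit_rings (N c) (n * H + r) omega)%N.
Proof.
rewrite /code_rings pickleK_inv /window /block /mkseq big_map.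
rewrite -(big_mkord xpredT
  (fun r => \sum_c unit_rings (N c) (n * H + r) omega)%N) /index_iota subn0.
by apply: eq_bigr => r _; apply: eq_bigr => c _; rewrite /= ffunE.
Qed.

Lemma sum_code_rings H n omega :
  (\sum_(k < n) code_rings (pickle (window H k omega)) =
   \sum_c N c (n * H)%:R omega)%N.
Proof.
elim: n => [|n IHn].
  rewrite big_ord0 big1// => c _.
  by have [_ -> _ _ _] := poisson_N c.
rewrite big_ord_recr /= {}IHn code_rings_window exchange_big -big_split /=.
apply: eq_bigr => c _; rewrite !(rings_unit_rings poisson_N) mulSnr.
by rewrite big_split_ord.
Qed.

Lemma measurable_rings c t n : 0 <= t -> measurable [set omega | N c t omega = n].
Proof.
move=> t0; have [mN _ _ _ _] := poisson_N c.
have -> : [set omega | N c t omega = n] = N c t @^-1` [set n] by apply/seteqP; split.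
by rewrite -[_ @^-1` _]setTI; exact: mN.
Qed.

Lemma rings_law c t n : 0 < t ->
  P [set omega | N c t omega = n] = (poisson_pmf (rate c * t) n)%:E.
Proof.
move=> t0; have [_ N0 _ lawN _] := poisson_N c.
rewrite -[in RHS](subr0 t) -lawN//; congr (P _).
by apply/seteqP; split=> omega /=; rewrite N0 subn0.
Qed.

Lemma rings_exp_moment c t x : 0 < t ->
  (\int[P]_omega (expR (x * (N c t omega)%:R))%:E =
   (expR (rate c * t * (expR x - 1)))%:E)%E.
Proof.
move=> t0; rewrite -poisson_exp_moment ?mulr_gt0//.
rewrite (@expectation_discrete _ _ _ P (N c t) (fun n => expR (x * n%:R))).
- by apply: eq_eseriesr => n _; rewrite rings_law.
- by move=> n; apply: measurable_rings; exact: ltW.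
- by move=> n; exact: expR_ge0.
Qed.

(** [expR_sum_le] reduces the total to the single clocks without a product formula for expectations.
    The bound tends to 1 as theta tends to 0, which is what [iid_tilted_lt1] requires. *)
Lemma total_rings_exp_moment theta t lambda : 0 < t -> 0 <= theta ->
  (forall c, rate c * t <= lambda) ->
  (\int[P]_omega (expR (theta * (\sum_c N c t omega)%N%:R))%:E <=
   (1 + #|C|%:R * (expR (lambda * (expR (#|C|%:R * theta) - 1)) - 1))%:E)%E.
Proof.
move=> t0 theta0 rate_le; set n : R := #|C|%:R.
have n0 : 0 <= n by [].
have mexp c (x : R) : measurable_fun setT (fun omega => (expR (x * (N c t omega)%:R))%:E).
  apply/measurable_EFinP.
  exact: (@measurable_real_discrete _ _ _ (fun=> N c t)
    (fun _ k => measurable_rings c k (ltW t0)) (fun k => expR (x * k%:R)) 0%N).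
have mtot : measurable_fun setT
    (fun omega => (expR (theta * (\sum_c N c t omega)%N%:R))%:E).
  apply/measurable_EFinP; apply: measurableT_comp => //.
  under eq_fun do rewrite natr_sum mulr_sumr.
  apply: measurable_sum => c.
  exact: (@measurable_real_discrete _ _ _ (fun=> N c t)
    (fun _ k => measurable_rings c k (ltW t0)) (fun k => theta * k%:R) 0%N).
(* The term [#|C|] stands on the left so that both integrands are nonnegative; it is subtracted
   after integration. *)
have : (\int[P]_omega ((expR (theta * (\sum_c N c t omega)%N%:R))%:E + n%:E) <=
    \int[P]_omega (1%:E + \sum_c (expR (n * theta * (N c t omega)%:R))%:E))%E.
  apply: ge0_le_integral => //.
  - by move=> omega _; rewrite adde_ge0// lee_fin// expR_ge0.
  - by apply: emeasurable_funD.
  - by apply: emeasurable_funD => //; apply: emeasurable_sum => c.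
  - move=> omega _; rewrite sumEFin -!EFinD lee_fin natr_sum mulr_sumr.
    under [X in _ <= _ + X]eq_bigr do rewrite -mulrA.
    by apply: expR_sum_le => c; rewrite mulr_ge0.
rewrite ge0_integralD//.
rewrite ge0_integralD//; last 2 first.
- by move=> omega _; apply: sume_ge0 => c _; rewrite lee_fin expR_ge0.
- by apply: emeasurable_sum => c.
rewrite ge0_integral_sum//.
rewrite !integral_cst//= !probability_setT !mule1.
under eq_bigr do rewrite rings_exp_moment//.
rewrite sumEFin -EFinD -leeBrDr// => /le_trans; apply.
set E := expR (lambda * _).
have -> : n * (E - 1) = \sum_(c : C) E - n by rewrite sumr_const mulrBr mulr1 mulr_natl.
rewrite -EFinB lee_fin addrA lerD2r lerD2l; apply: ler_sum => c _.
by rewrite ler_expR ler_wpM2r// subr_ge0 -expR0 ler_expR mulr_ge0.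
Qed.

Lemma window_rewards (H : nat) (gs : seq symbol) (theta kappa : R) (B : nat) :
  (0 < H)%N -> size gs = H -> 0 < \prod_(s <- gs) symbol_prob rate c0 s ->
  0 < theta -> 0 <= kappa -> expR (- (theta * kappa)) <= 2^-1 ->
  #|C|%:R * (expR ((\sum_c rate c) * H%:R * (expR (#|C|%:R * theta) - 1)) - 1) <
    (\prod_(s <- gs) symbol_prob rate c0 s) / 2 ->
  exists G : set Omega, [/\ measurable G, (0 < P G)%E &
    forall omega, G omega -> forall n, window H n omega = gs \/
      (\sum_c N c (n.+1 * H)%:R omega + B)%N%:R <=
      (2 * (\sum_(x <- gs) \sum_c (x : symbol).1 c)%N%:R + 1 + B%:R + kappa) *
      (\sum_(k < n) (window H k omega == gs))%N%:R].
Proof.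
move=> H0 gsH gs0 theta0 kappa0 kappa_ge theta_lt.
have mS := measurable_unit_symbol U c0 poisson_N.
have S_word := unit_symbol_word c0 poisson_N uniform_U indep.
pose X n omega := pickle (window H n omega).
pose q := block_prob (symbol_prob rate c0) H.
have mX n s : measurable [set omega | X n omega = s] by exact: measurable_block.
have X_word : forall w : seq nat,
  P [set omega | mkseq (X^~ omega) (size w) = w] = (\prod_(s <- w) q s)%:E.
  exact: block_word.
have q0 k : 0 <= q k.
  rewrite /q /block_prob; case: pickle_inv => // s; case: ifP => // _.
  by rewrite prodr_ge0// => x _; exact: symbol_prob_ge0.
have qg : q (pickle gs) = \prod_(s <- gs) symbol_prob rate c0 s.
  by rewrite /q /block_prob pickleK_inv gsH eqxx.
have ell_g : code_rings (pickle gs) = (\sum_(x <- gs) \sum_c (x : symbol).1 c)%N.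
  by rewrite /code_rings pickleK_inv.
have qlt : (\sum_(s <oo) (q s * expR (theta * (code_rings s)%:R))%:E <
    (1 + q (pickle gs) / 2)%:E)%E.
  (* The first window covers the times from 0 to H, so the series is an exponential moment of the
     counts at the single time H. *)
  have -> : (\sum_(s <oo) (q s * expR (theta * (code_rings s)%:R))%:E =
      \int[P]_omega (expR (theta * (\sum_c N c H%:R omega)%N%:R))%:E)%E.
    transitivity (\int[P]_omega (expR (theta * (code_rings (X 0%N omega))%:R))%:E)%E.
      rewrite (@expectation_discrete _ _ _ P (X 0%N)
        (fun s => expR (theta * (code_rings s)%:R)))//.
      apply: eq_eseriesr => s _.
      have -> : [set omega | X 0%N omega = s] =
          [set omega | mkseq (X^~ omega) (size [:: s]) = [:: s]].
        by apply/seteqP; split=> omega; [move=> /= <-|case].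
      by rewrite X_word big_seq1 mulrC EFinM.
    apply: eq_integral => omega _.
    by have := sum_code_rings H 1 omega; rewrite big_ord1 mul1n => ->.
  have Hr : 0 < H%:R :> R by rewrite ltr0n.
  apply: (le_lt_trans (@total_rings_exp_moment theta H%:R
    ((\sum_c rate c) * H%:R) Hr (ltW theta0) _)).
    move=> c; rewrite ler_pM2r// (bigD1 c)//= lerDl sumr_ge0// => c' _.
    exact: ltW.
  by rewrite lte_fin ltrD2l qg.
have qg0 : 0 < q (pickle gs) by rewrite qg.
have [G [mG PG GP]] := iid_reward_dominates mX q0 X_word B
  qg0 theta0 kappa0 kappa_ge qlt.
exists G; split=> // omega Gomega n; have [Xg|le_n] := GP omega Gomega n.
  by left; exact: (pcan_inj pickleK Xg).
right; rewrite -sum_code_rings -ell_g.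
under [X in _ <= _ * X%:R]eq_bigr do rewrite -(inj_eq (pcan_inj (@pickleK (seq symbol)))).
exact: le_n.
Qed.

End windows.

(** The point is the order of quantifiers: [nu] is fixed before the probability space and the
    processes. The value [ln 2 / theta] of kappa makes exp(- theta kappa) equal to 1/2. *)
Lemma window_rewards_const (R : realType) (C : finType) (rate : C -> R) (c0 : C)
    (H : nat) (gs : seq ({ffun C -> nat} * seq nat)) (B : nat) :
  (forall c, 0 < rate c) -> (0 < H)%N -> size gs = H ->
  0 < \prod_(s <- gs) symbol_prob rate c0 s ->
  exists2 nu : R, 0 < nu &
  forall (disp : measure_display) (Omega : measurableType disp)
    (P : probability Omega R) (N : C -> R -> Omega -> nat)
    (U : C -> nat -> {RV P >-> R}),
  (forall c, poisson_process P (rate c) (N c)) ->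
  (forall c n B, measurable B ->
    distribution P (U c n) B = uniform_prob (@ltr01 R) B) ->
  mutually_independent P (fun a : C + C * nat =>
    match a with
    | inl c => sigma_process (N c)
    | inr (c, n) => sigma_var (U c n)
    end) ->
  exists G : set Omega, [/\ measurable G, (0 < P G)%E &
    forall omega, G omega -> forall n, window N U c0 H n omega = gs \/
      (\sum_c N c (n.+1 * H)%:R omega + B)%N%:R <=
      nu * (\sum_(k < n) (window N U c0 H k omega == gs))%N%:R].
Proof.
move=> rate0 H0 gsH gs0.
have C0 : (0 < #|C|)%N by apply/card_gt0P; exists c0.
have lambda0 : 0 < (\sum_c rate c) * H%:R.
  rewrite mulr_gt0 ?ltr0n// (bigD1 c0)//= ltr_pwDl// sumr_ge0// => c _; exact: ltW.
have [theta theta0 theta_lt] := small_exponent lambda0 (divr_gt0 gs0 (@ltr0Sn R 1)) C0.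
have ln2 : 0 <= ln 2 :> R by rewrite ln_ge0// ler1n.
have kappa0 : 0 <= ln 2 / theta by rewrite divr_ge0// ltW.
have kappa_ge : expR (- (theta * (ln 2 / theta))) <= 2^-1.
  by rewrite mulrCA mulfV ?gt_eqF// mulr1 expRN lnK// posrE.
exists (2 * (\sum_(x <- gs) \sum_c x.1 c)%N%:R + 1 + B%:R + ln 2 / theta).
  by rewrite ltr_wpDr// ltr_wpDr// ltr_pwDr// mulr_ge0.
move=> disp Omega P N U poisson_N uniform_U indep.
exact: (window_rewards rate0 poisson_N uniform_U indep B H0 gsH gs0 theta0 kappa0 kappa_ge).
Qed.

(** * Simultaneous rings *)

Lemma set_seq_cons (I : eqType) (i : I) (s : seq I) : [set` i :: s] = i |` [set` s].
Proof.
by apply/seteqP; split=> j /=; [rewrite inE => /predU1P|move=> /predU1P; rewrite inE].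
Qed.

Lemma measure_bigcup_seq_le (R : realType) (disp : measure_display)
    (Omega : measurableType disp) (P : {measure set Omega -> \bar R}) (I : eqType) (s : seq I)
    (A : I -> set Omega) : (forall i, measurable (A i)) ->
  (P (\bigcup_(i in [set` s]) A i) <= \sum_(i <- s) P (A i))%E.
Proof.
move=> mA; elim: s => [|i s IHs].
  by rewrite set_nil bigcup_set0 measure0 big_nil.
rewrite set_seq_cons bigcup_setU1 big_cons.
apply: (le_trans (measureU2 _ _ _)) => //; last by rewrite leeD2l.
exact: fin_bigcup_measurable.
Qed.

Section simultaneous_rings.
Context (R : realType) (C : finType) (rate : C -> R) (disp : measure_display)
  (Omega : measurableType disp) (P : probability Omega R)
  (N : C -> R -> Omega -> nat).
Hypothesis rate_gt0 : forall c, 0 < rate c.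
Hypothesis poisson_N : forall c, poisson_process P (rate c) (N c).
Hypothesis indep : mutually_independent P (fun c => sigma_process (N c)).

Definition rings c (s t : R) (omega : Omega) : nat := (N c t omega - N c s omega)%N.

(** The measurable space is arbitrary because the lemma serves twice: on [Omega], and on the
    sigma-algebra generated by one clock, as independence demands. *)
Lemma measurable_ge_rings_gen (disp' : measure_display) (Omega' : measurableType disp')
    (M : R -> Omega' -> nat) (s t : R) (k : nat) :
  (forall t, 0 <= t -> measurable_fun setT (M t)) -> 0 <= s -> s <= t ->
  measurable [set omega | (k <= M t omega - M s omega)%N].
Proof.
move=> mM s0 st; have mI : measurable_fun setT (fun omega => M t omega - M s omega)%N.
  by apply: measurable_fun_subn; apply: mM => //; exact: le_trans st.
have -> : [set omega | (k <= M t omega - M s omega)%N] =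
    (fun omega => M t omega - M s omega)%N @^-1` [set n | (k <= n)%N].
  by apply/seteqP; split.
by rewrite -[_ @^-1` _]setTI; exact: mI.
Qed.

Lemma measurable_ge_rings c s t k : 0 <= s -> s <= t ->
  measurable [set omega | (k <= rings c s t omega)%N].
Proof.
by move=> s0 st; apply: measurable_ge_rings_gen => //; have [] := poisson_N c.
Qed.

Lemma sigma_ge_rings c s t k : 0 <= s -> s <= t ->
  sigma_process (N c) [set omega | (k <= rings c s t omega)%N].
Proof.
exact: (measurable_ge_rings_gen k (@measurable_fun_sigma_process R disp Omega (N c))).
Qed.

Lemma measurable_eq_rings c s t k : 0 <= s -> s <= t ->
  measurable [set omega | rings c s t omega = k].
Proof.
move=> s0 st.
have -> : [set omega | rings c s t omega = k] =
    [set omega | (k <= rings c s t omega)%N] `\` [set omega | (k.+1 <= rings c s t omega)%N].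
  apply/seteqP; split=> omega /=; first by move=> ->; rewrite leqnn ltnn.
  by move=> [kr /negP]; rewrite -leqNgt => rk; apply/eqP; rewrite eqn_leq rk kr.
by apply: measurableD; exact: measurable_ge_rings.
Qed.

Lemma prob_ring_le c s t : 0 <= s -> s < t ->
  (P [set omega | (1 <= rings c s t omega)%N] <= (rate c * (t - s))%:E)%E.
Proof.
move=> s0 st; have x0 : 0 < rate c * (t - s) by rewrite mulr_gt0 ?subr_gt0.
have [_ _ _ law _] := poisson_N c.
have -> : [set omega | (1 <= rings c s t omega)%N] = ~` [set omega | rings c s t omega = 0%N].
  by apply/seteqP; split=> omega /=; rewrite lt0n => /eqP.
rewrite probability_setC; last by apply: measurable_eq_rings => //; exact: ltW.
rewrite law// /poisson_pmf x0 expr0 fact0 invr1 !mul1r -EFinB lee_fin.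
have := expR_ge1Dx (- (rate c * (t - s))); lra.
Qed.

Lemma prob_two_rings_le c s t : 0 <= s -> s < t ->
  (P [set omega | (2 <= rings c s t omega)%N] <= ((rate c * (t - s)) ^+ 2)%:E)%E.
Proof.
move=> s0 st; have x0 : 0 < rate c * (t - s) by rewrite mulr_gt0 ?subr_gt0.
have [_ _ _ law _] := poisson_N c.
have mr k : measurable [set omega | rings c s t omega = k].
  by apply: measurable_eq_rings => //; exact: ltW.
have -> : [set omega | (2 <= rings c s t omega)%N] =
    ~` ([set omega | rings c s t omega = 0%N] `|` [set omega | rings c s t omega = 1%N]).
  apply/seteqP; split=> omega /=; case: (rings c s t omega) => [|[|n]] //=.
  - by move=> _ [].
  - by case; left.
  - by case; right.
rewrite probability_setC; last exact: measurableU.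
have -> : P ([set omega | rings c s t omega = 0%N] `|` [set omega | rings c s t omega = 1%N]) =
    (poisson_pmf (rate c * (t - s)) 0 + poisson_pmf (rate c * (t - s)) 1)%:E.
  rewrite measureU//; first by rewrite EFinD; congr (_ + _)%E; exact: law.
  by apply/seteqP; split=> // omega [/= -> ].
rewrite /poisson_pmf x0 expr0 expr1 factS fact0 muln1 invr1 !mul1r mulr1 -EFinB lee_fin.
set x := rate c * (t - s) in x0 *.
(* 1 - e^(-x) (1 + x) <= 1 - (1 - x)(1 + x) = x^2. *)
have e1 := expR_ge1Dx (- x); rewrite expr2; nra.
Qed.

(** Two rings come either from one clock ringing twice, the diagonal pairs, or from two distinct
    clocks. Both have probability quadratic in the length of the interval. *)
Definition ring_pair (s t : R) (p : C * C) : set Omega :=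
  if p.1 == p.2 then [set omega | (2 <= rings p.1 s t omega)%N]
  else [set omega | (1 <= rings p.1 s t omega)%N] `&`
       [set omega | (1 <= rings p.2 s t omega)%N].

Lemma measurable_ring_pair s t p : 0 <= s -> s < t -> measurable (ring_pair s t p).
Proof.
move=> s0 /ltW st; rewrite /ring_pair; case: ifP => _.
  exact: measurable_ge_rings.
by apply: measurableI; exact: measurable_ge_rings.
Qed.

Lemma prob_ring_pair_le s t p : 0 <= s -> s < t ->
  (P (ring_pair s t p) <= (rate p.1 * rate p.2 * (t - s) ^+ 2)%:E)%E.
Proof.
move=> s0 st; rewrite /ring_pair; have [<-|p12] := eqVneq p.1 p.2.
  by apply: le_trans (prob_two_rings_le _ s0 st) _; rewrite lee_fin exprMn expr2.
pose A c := [set omega | (1 <= rings c s t omega)%N].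
have -> : A p.1 `&` A p.2 = \bigcap_(c in [set` [:: p.1; p.2]]) A c.
  by rewrite !set_seq_cons set_nil setU0 bigcap_setU !bigcap_set1.
rewrite indep/= ?inE ?p12//; last first.
  by move=> c _; apply: sigma_ge_rings => //; exact: ltW.
rewrite !big_cons big_nil mule1.
apply: le_trans (lee_pmul _ _ (prob_ring_le p.1 s0 st) (prob_ring_le p.2 s0 st)) _ => //.
by rewrite -EFinM lee_fin expr2 mulrACA.
Qed.

Lemma two_rings_pair s t omega : (2 <= \sum_c rings c s t omega)%N ->
  exists p, ring_pair s t p omega.
Proof.
move=> two; have [c c1] : exists c, (1 <= rings c s t omega)%N.
  apply/existsP; apply: contraLR two => /existsPn no; rewrite big1// => c _.
  by apply/eqP; rewrite -leqn0 leqNgt.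
have [c2|c2] := leqP 2 (rings c s t omega).
  by exists (c, c); rewrite /ring_pair eqxx.
have [c' c'c c'1] : exists2 c', c' != c & (1 <= rings c' s t omega)%N.
  apply/exists_inP; apply: contraLR two => /exists_inPn no.
  rewrite (bigD1 c)//= big1 ?addn0 -?ltnNge// => c' c'c.
  by apply/eqP; rewrite -leqn0 leqNgt; exact: no.
by exists (c, c'); rewrite /ring_pair /= eq_sym (negbTE c'c).
Qed.

Let grid (n k j : nat) : R := n%:R + j%:R / k.+1%:R.

Let crowded n k : set Omega :=
  \bigcup_(x in [set` [seq (j, p) | j <- iota 0 k.+1, p <- enum {: C * C}]])
    ring_pair (grid n k x.1) (grid n k x.1.+1) x.2.

(** Each of the k + 1 cells of [n, n + 1] holds two rings with probability at most M / (k + 1)^2, so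
    some cell does with probability at most M / (k + 1). That this happens for every k is therefore
    a null event. *)
Lemma no_simultaneous_rings : exists Z : set Omega, [/\ measurable Z, P Z = 0 &
  forall omega, ~ Z omega -> forall n, exists k, forall j, (j < k.+1)%N ->
    (\sum_c rings c (n%:R + j%:R / k.+1%:R) (n%:R + j.+1%:R / k.+1%:R) omega <= 1)%N].
Proof.
have grid0 n k j : 0 <= grid n k j by rewrite addr_ge0// divr_ge0.
have gridlt n k j : grid n k j < grid n k j.+1.
  by rewrite ltrD2l ltr_pM2r ?ltr_nat// invr_gt0.
have gridB n k j : grid n k j.+1 - grid n k j = k.+1%:R^-1.
  rewrite /grid -[j.+1%:R]natr1; ring.
have mcrowded n k : measurable (crowded n k).
  apply: fin_bigcup_measurable => // x _; exact: measurable_ring_pair.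
pose M := \sum_(p : C * C) rate p.1 * rate p.2.
have M0 : 0 <= M by apply: sumr_ge0 => p _; rewrite mulr_ge0// ltW.
have Pcrowded n k : (P (crowded n k) <= (M / k.+1%:R)%:E)%E.
  apply: (le_trans (@measure_bigcup_seq_le _ _ _ P _ _ _ _)).
    by move=> x; exact: measurable_ring_pair.
  rewrite big_allpairs /=.
  apply: (@le_trans _ _ (\sum_(j <- iota 0 k.+1) (M * k.+1%:R^-1 ^+ 2)%:E)%E).
    apply: lee_sum => j _; rewrite big_enum /= /M mulr_suml -sumEFin.
    apply: lee_sum => p _; rewrite -(gridB n k j).
    exact: prob_ring_pair_le.
  rewrite sumEFin big_const_seq count_predT size_iota iter_addr_0 -mulr_natl lee_fin.
  rewrite le_eqVlt; apply/orP; left; apply/eqP; field.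
  by rewrite nat1r pnatr_eq0.
have mcap n : measurable (\bigcap_k crowded n k) by exact: bigcapT_measurable.
have Pcap n : P (\bigcap_k crowded n k) = 0.
  have Pk k : (P (\bigcap_k crowded n k) <= (M / k.+1%:R)%:E)%E.
    apply: le_trans (Pcrowded n k); apply: le_measure; rewrite ?inE//.
    exact: bigcap_inf.
  apply/eqP; rewrite eq_le measure_ge0 andbT.
  have fP : P (\bigcap_k crowded n k) \is a fin_num by exact: fin_num_measure.
  rewrite -(fineK fP) lee_fin leNgt; apply/negP => r0.
  (* A positive probability p would contradict the bound at a k with k + 1 > M / p. *)
  move: (Pk (Num.truncn (M / fine (P (\bigcap_k crowded n k))))).
  have := truncnS_gt (M / fine (P (\bigcap_k crowded n k))).
  set k := Num.truncn _; rewrite -[in leLHS](fineK fP) lee_fin ler_pdivlMr//.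
  by rewrite ltr_pdivrMr// => lt1 le2; move: (le_lt_trans le2 lt1); rewrite mulrC ltxx.
exists (\bigcup_n \bigcap_k crowded n k); split.
- exact: bigcupT_measurable.
- apply/eqP; rewrite eq_le measure_ge0 andbT.
  apply: (le_trans (measure_sigma_subadditive P mcap _ (@subset_refl _ _))).
    exact: bigcupT_measurable.
  by rewrite eseries0// => n _ _; exact: Pcap.
move=> omega notZ n.
have [k notk] : exists k, ~ crowded n k omega.
  by apply/existsNP => crowded_all; apply: notZ; exists n => // k _; exact: crowded_all.
exists k => j jk; rewrite leqNgt; apply/negP => /two_rings_pair[p pj]; apply: notk.
exists (j, p) => //; apply/allpairsP; exists (j, p); split => //.
  by rewrite mem_iota.
by rewrite mem_enum.
Qed.
End simultaneous_rings.

(** * One update of the configuration *)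

Section updates.
Context (R : realType) (m K : nat) (w0 wc : R) (pay : payoffs R).
Implicit Types (x y : config R m K) (c : clock K) (u : R) (i j : 'I_K).

Definition unborn_count x : nat := size (unborn x).

(* A birth lowers the wealth of the parent by w0 but uses up an unborn particle. *)
Definition reserve x i : R := wealth (x i) - w0 * (unborn_count x)%:R.

Definition max_loss (z : strategy) : R :=
  match z with
  | Unborn => 0 | Cooperator => payS pay | Defector => 2 * payP pay
  end.

Lemma choose_mem (T : eqType) (j0 : T) (s : seq T) u : choose j0 (j0 :: s) u \in j0 :: s.
Proof.
rewrite /choose; set n := Num.truncn _.
have [ns|sn] := ltnP n (size (j0 :: s)); first exact: mem_nth.
by rewrite nth_default// mem_head.
Qed.

Lemma unborn_countE x : unborn_count x = #|[pred j | ~~ is_born (strat (x j))]|.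
Proof. by rewrite cardE /unborn_count /unborn enumT. Qed.

Lemma unborn_count_le x : (unborn_count x <= K)%N.
Proof. by rewrite unborn_countE -[leqRHS](card_ord K) max_card. Qed.

Lemma eq_unborn_count x y : (forall i, strat (x i) = strat (y i)) ->
  unborn_count x = unborn_count y.
Proof.
by move=> xy; rewrite !unborn_countE; apply: eq_card => j; rewrite !inE xy.
Qed.

Lemma do_moveE i u x k :
  strat (do_move i u x k) = strat (x k) /\ wealth (do_move i u x k) = wealth (x k).
Proof. by rewrite /do_move /set_particle; case: eqP => // ->. Qed.

Lemma do_game_strat i j u x k : strat (do_game pay i j u x k) = strat (x k).
Proof.
rewrite /do_game; case: ifP => // _; rewrite /set_particle.
by case: eqP => [->//|_]; case: eqP => [->|].
Qed.

Lemma do_game_position i j u x k : position (do_game pay i j u x k) = position (x k).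
Proof.
rewrite /do_game; case: ifP => // _; rewrite /set_particle.
by case: eqP => [->//|_]; case: eqP => [->|].
Qed.

Lemma game_payoff_ge z z' heads :
  0 <= payR pay -> 0 <= payT pay -> 0 <= payS pay -> 0 <= payP pay ->
  - max_loss z <= (game_payoff pay z z' heads).1 /\
  - max_loss z' <= (game_payoff pay z z' heads).2.
Proof.
by move=> R0 T0 S0 P0; case: z z' => [] [] //=; try case: heads => /=; split; lra.
Qed.

Lemma update_strat c u x i : is_born (strat (x i)) ->
  strat (update w0 wc pay c u x i) = strat (x i).
Proof.
case: c => [[k|e]|k] born_i /=.
- by case: (do_moveE k u x i).
- exact: do_game_strat.
rewrite /do_birth; case: ifP => // /andP[born_k _].
case E : (unborn x) => [|j0 s] //; rewrite /set_particle.
case: eqP => [ij|_]; last by case: eqP => [->|].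
have : choose j0 (j0 :: s) u \in unborn x by rewrite E choose_mem.
by rewrite -ij mem_filter born_i.
Qed.

Hypothesis payR_ge0 : 0 <= payR pay.
Hypothesis payT_ge0 : 0 <= payT pay.
Hypothesis payS_ge0 : 0 <= payS pay.
Hypothesis payP_ge0 : 0 <= payP pay.
Hypothesis w0_ge0 : 0 <= w0.

Lemma max_loss_ge0 z : 0 <= max_loss z.
Proof. by case: z => //=; rewrite mulr_ge0. Qed.

(** Moves change no wealth, and a game costs at most [max_loss]. A birth costs its parent w0, but it
    strictly shrinks the set of unborn particles, so it lowers nobody's reserve. *)
Lemma update_reserve c u x i : is_born (strat (x i)) ->
  reserve x i - max_loss (strat (x i)) <= reserve (update w0 wc pay c u x) i.
Proof.
move=> born_i; have loss0 := max_loss_ge0 (strat (x i)).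
rewrite /reserve; case: c => [[k|e]|k] /=.
- have [_ ->] := do_moveE k u x i.
  rewrite (@eq_unborn_count (do_move k u x) x); first lra.
  by move=> j; case: (do_moveE k u x j).
- rewrite (@eq_unborn_count (do_game pay (val e).1 (val e).2 u x) x); last first.
    by move=> j; exact: do_game_strat.
  rewrite /do_game; case: ifP => [_|]; last lra.
  set g := game_payoff _ _ _ _; rewrite /set_particle.
  have [g1 g2] := game_payoff_ge (strat (x (val e).1)) (strat (x (val e).2))
    (u < 2^-1) payR_ge0 payT_ge0 payS_ge0 payP_ge0.
  case: eqP => [->|_] /=; first by rewrite -/g in g2; lra.
  by case: eqP => [->|_] /=; [rewrite -/g in g1; lra|lra].
- rewrite /do_birth; case: ifP => [/andP[born_k _]|]; last lra.
  case E : (unborn x) => [|j0 s]; first lra.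
  set j := choose _ _ _; set y := set_particle _ _ _.
  have jx : j \in unborn x by rewrite E choose_mem.
  have ij : i != j.
    by apply: contraTneq jx => <-; rewrite mem_filter born_i.
  have kj : k != j.
    by apply: contraTneq jx => <-; rewrite mem_filter born_k.
  have lt_yx : (unborn_count y < unborn_count x)%N.
    rewrite !unborn_countE; apply: proper_card; apply/properP; split.
      apply/fintype.subsetP => l; rewrite !inE /y /set_particle.
      case: eqP => [_|_]; first by rewrite /= born_k.
      by case: eqP => [->|_].
    exists j; first by move: jx; rewrite mem_filter inE => /andP[].
    by rewrite inE /y /set_particle eqxx /= born_k.
  have le_yx : (unborn_count y)%:R + 1 <= (unborn_count x)%:R :> R.
    by rewrite natr1 ler_nat.
  have : w0 * (unborn_count y)%:R + w0 <= w0 * (unborn_count x)%:R.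
    by rewrite -[X in _ + X](mulr1 w0) -mulrDr ler_wpM2l.
  rewrite {2}/y /set_particle (negbTE ij).
  by case: eqP => [<-|_] /= le_w; have w0_nneg := w0_ge0; lra.
Qed.

End updates.

(** * Perfect windows *)

Section patterns.
Context (R : realType) (m K : nat) (w0 wc : R) (pay : payoffs R).
Implicit Types (x y z : config R m K) (c : clock K) (u : R) (i j : 'I_K).

Definition move_clock i : clock K := inl (inl i).

(** Clocks exist only for pairs listed in increasing order, hence the swap. The fallback is reached
    only for i = j. *)
Definition game_clock i j : clock K :=
  if insub (if (i < j)%N then (i, j) else (j, i)) is Some e then inl (inr e)
  else move_clock i.

Lemma game_clockP i j : i != j -> exists e : {e : 'I_K * 'I_K | (e.1 < e.2)%N},
  game_clock i j = inl (inr e) /\ (val e = (i, j) \/ val e = (j, i)).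
Proof.
move=> ij; rewrite /game_clock; case: insubP => [e _ ve|].
  by exists e; split=> //; rewrite ve; case: ifP; [left|right].
case: (ltngtP i j) => /= [->//|->//|/val_inj eq_ij].
by rewrite eq_ij eqxx in ij.
Qed.

(* The second components of a pattern only matter for moves. *)
Fixpoint follows (p : seq (clock K * nat)) x y : Prop :=
  match p with
  | [::] => y = x
  | (c, a) :: p' => exists u,
      (if c is inl (inl _) then direction u = a else True) /\
      follows p' (update w0 wc pay c u x) y
  end.

Lemma follows_cat p1 p2 x y :
  follows (p1 ++ p2) x y <-> exists z, follows p1 x z /\ follows p2 z y.
Proof.
elim: p1 x => [|[c a] p1 IHp] x /=.
  by split=> [xy|[z [-> zy]]//]; exists x.
split.
  by move=> [u [ua /IHp[z [xz zy]]]]; exists z; split=> //; exists u.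
by move=> [z [[u [ua xz]] zy]]; exists u; split=> //; apply/IHp; exists z.
Qed.

Lemma follows_rcons p c a x y :
  follows (rcons p (c, a)) x y <-> exists z, follows p x z /\ exists u,
    (if c is inl (inl _) then direction u = a else True) /\
    y = update w0 wc pay c u z.
Proof. by rewrite -cats1 follows_cat. Qed.

Definition neighbour (pos : 'I_m * 'I_m) (a : nat) : 'I_m * 'I_m :=
  nth pos (neighbours pos) a.

Lemma update_move i u x : (direction u < 4)%N ->
  [/\ position (update w0 wc pay (move_clock i) u x i) = neighbour (position (x i)) (direction u),
    forall k, k != i -> position (update w0 wc pay (move_clock i) u x k) = position (x k) &
    forall k, wealth (update w0 wc pay (move_clock i) u x k) = wealth (x k) /\
              strat (update w0 wc pay (move_clock i) u x k) = strat (x k)].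
Proof.
move=> u4; split.
- rewrite /= /do_move /set_particle eqxx /choose /neighbour /=.
  by apply: set_nth_default.
- by move=> k /negbTE ki; rewrite /= /do_move /set_particle ki.
- by move=> k; have [-> ->] := do_moveE i u x k.
Qed.

Definition meets x i j : bool := position (x i) == position (x j).

Lemma update_game i j u x (y := update w0 wc pay (game_clock i j) u x) :
  i != j -> alive (x i) -> alive (x j) -> strat (x i) = Cooperator ->
  [/\ forall k, position (y k) = position (x k),
      forall k, strat (y k) = strat (x k),
      forall k, k != i -> k != j -> wealth (y k) = wealth (x k),
      wealth (y i) = if meets x i j then
        wealth (x i) + (if strat (x j) is Defector then - payS pay else payR pay)
        else wealth (x i) &
      wealth (y j) = if meets x i j then
        wealth (x j) + (if strat (x j) is Defector then payT pay else payR pay)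
        else wealth (x j)].
Proof.
move=> ij ai aj si; have [e [gE vE]] := game_clockP ij.
rewrite {}/y gE /=; split.
- by move=> k; exact: do_game_position.
- by move=> k; exact: do_game_strat.
- move=> k ki kj; rewrite /do_game; case: ifP => // _; rewrite /set_particle.
  by case: vE => -> /=; rewrite (negbTE ki) (negbTE kj).
- case: vE => -> /=; rewrite /do_game /meets ?[_ == position (x i)]eq_sym ai aj !andbT.
    case: ifP => // _; rewrite /set_particle (negbTE ij) eqxx /= si.
    by move: aj; rewrite /alive; case: (strat (x j)).
  case: ifP => // _; rewrite /set_particle eqxx /= si.
  by move: aj; rewrite /alive; case: (strat (x j)).
- case: vE => -> /=; rewrite /do_game /meets ?[_ == position (x i)]eq_sym ai aj !andbT.
    case: ifP => // _; rewrite /set_particle eqxx /= si.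
    by move: aj; rewrite /alive; case: (strat (x j)).
  case: ifP => // _; rewrite /set_particle eq_sym (negbTE ij) eqxx /= si.
  by move: aj; rewrite /alive; case: (strat (x j)).
Qed.


Context (C D : {set 'I_K}) (i0 : 'I_K).
Hypothesis i0C : i0 \in C.
Hypothesis payR_gt0 : 0 < payR pay.
Hypothesis payT_gt0 : 0 < payT pay.
Hypothesis payS_gt0 : 0 < payS pay.

Definition all_alive x : Prop :=
  (forall i, i \in C -> strat (x i) = Cooperator /\ 0 < wealth (x i)) /\
  (forall i, i \in D -> strat (x i) = Defector /\ 0 < wealth (x i)).

Definition admissible (J : {set 'I_K}) (e : clock K * nat) : Prop :=
  (e.1 = move_clock i0 /\ (e.2 < 4)%N) \/
  (exists2 j, j \in J :\ i0 & e.1 = game_clock i0 j).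

Definition moved (pos : 'I_m * 'I_m) (e : clock K * nat) : 'I_m * 'I_m :=
  if e.1 is inl (inl _) then neighbour pos e.2 else pos.

Lemma alive_in x i : all_alive x -> i \in C :|: D -> alive (x i).
Proof.
by move=> [xC xD]; rewrite finset.in_setU => /orP[/xC|/xD] [si wi]; rewrite /alive si wi.
Qed.

(** The parameter b bounds the loss of [i0] in one entry: 0 among cooperators, S among defectors, so
    one proof serves both phases. Nobody else can lose, since a partner of the cooperator [i0]
    receives R or T. *)
Lemma update_admissible (J : {set 'I_K}) (b : R) e u x (y := update w0 wc pay e.1 u x) :
  J \subset C :|: D -> 0 <= b -> (forall j, j \in J -> j \in D -> payS pay <= b) ->
  admissible J e -> (if e.1 is inl (inl _) then direction u = e.2 else True) ->
  all_alive x -> b < wealth (x i0) ->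
  [/\ all_alive y,
      forall k, k != i0 -> k \in C :|: D -> wealth (x k) <= wealth (y k),
      wealth (x i0) - b <= wealth (y i0),
      forall k, strat (y k) = strat (x k) /\ (k != i0 -> position (y k) = position (x k)) &
      position (y i0) = moved (position (x i0)) e].
Proof.
move=> JCD b0 bS adm dir okx bw.
suff [wk wi0 sk pi0] : [/\ forall k, k != i0 -> k \in C :|: D -> wealth (x k) <= wealth (y k),
      wealth (x i0) - b <= wealth (y i0),
      forall k, strat (y k) = strat (x k) /\ (k != i0 -> position (y k) = position (x k)) &
      position (y i0) = moved (position (x i0)) e].
  split=> //; split=> i iCD.
    have [si wi] := okx.1 i iCD; rewrite (sk i).1; split=> //.
    have [->|ii0] := eqVneq i i0; first by apply: lt_le_trans wi0; rewrite subr_gt0.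
    by apply: lt_le_trans wi _; apply: wk; rewrite // finset.in_setU iCD.
  have [si wi] := okx.2 i iCD; rewrite (sk i).1; split=> //.
  have [ii0|ii0] := eqVneq i i0.
    by have := (okx.1 i0 i0C).1; rewrite -ii0 si.
  by apply: lt_le_trans wi _; apply: wk; rewrite // finset.in_setU iCD orbT.
case: adm => [[eE e4]|[j]].
  rewrite eE /= in dir.
  have [] := @update_move i0 u x; first by rewrite dir.
  rewrite -eE -/y => yi0 yk y_same; split.
  - by move=> k _ _; rewrite (y_same k).1.
  - by rewrite (y_same i0).1; lra.
  - by move=> k; split; [exact: (y_same k).2|exact: yk].
  - by rewrite yi0 /moved eE dir.
rewrite finset.in_setD1 => /andP[ji0 jJ] eE.
have i0j : i0 != j by rewrite eq_sym.
have jCD : j \in C :|: D by exact: (fintype.subsetP JCD).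
have ai0 : alive (x i0) by apply: alive_in => //; rewrite finset.in_setU i0C.
have [] := update_game u i0j ai0 (alive_in okx jCD) (okx.1 i0 i0C).1.
rewrite -eE -/y => py sy wy wi0 wj; split.
- move=> k ki0 kCD; have [->|kj] := eqVneq k j; last by rewrite wy.
  by rewrite wj; case: ifP => // _; rewrite lerDl; case: strat => //; exact: ltW.
- rewrite wi0; case: ifP => _; last lra.
  have R0 := payR_gt0; case sj : (strat (x j)); [lra|lra|].
  suff payS_le : payS pay <= b by lra.
  apply: bS jJ _; move: jCD; rewrite finset.in_setU => /orP[/okx.1[]|//].
  by rewrite sj.
- by move=> k; rewrite sy py.
- by rewrite py /moved eE; have [e' [-> _]] := game_clockP i0j.
Qed.

Lemma follows_admissible (J : {set 'I_K}) (b : R) p x y :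
  J \subset C :|: D -> 0 <= b -> (forall j, j \in J -> j \in D -> payS pay <= b) ->
  (forall e, e \in p -> admissible J e) ->
  all_alive x -> b * (size p)%:R < wealth (x i0) -> follows p x y ->
  [/\ all_alive y,
      forall k, k != i0 -> k \in C :|: D -> wealth (x k) <= wealth (y k),
      wealth (x i0) - b * (size p)%:R <= wealth (y i0),
      forall k, strat (y k) = strat (x k) /\ (k != i0 -> position (y k) = position (x k)) &
      position (y i0) = foldl moved (position (x i0)) p].
Proof.
move=> JCD b0 bS; elim: p x => [|e p IHp] x adm okx bw /=.
  by move=> ->; rewrite mulr0 subr0; split.
case: e adm bw => [c a] adm bw [u [ua py]].
have sp : b * (size ((c, a) :: p))%:R = b + b * (size p)%:R.
  by rewrite /= -natr1; ring.
have bp0 : 0 <= b * (size p)%:R by rewrite mulr_ge0.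
have [okz wz wzi0 sz pz] := @update_admissible J b (c, a) u x JCD b0 bS
  (adm _ (mem_head _ _)) ua okx ltac:(lra).
have [e ep| |oky wy wyi0 sy ppy] := IHp (update w0 wc pay c u x) _ okz _ py.
  by apply: adm; rewrite inE ep orbT.
- by rewrite /= in wzi0; lra.
split=> //.
- by move=> k ki0 kCD; apply: le_trans (wz k ki0 kCD) (wy k ki0 kCD).
- by rewrite /= in wzi0; rewrite sp; lra.
- move=> k; rewrite (sy k).1 (sz k).1; split=> // ki0.
  by rewrite (sy k).2// (sz k).2.
- by rewrite ppy pz.
Qed.

(** When the walk of [i0] reaches the site of j just before their clock rings, both are still alive,
    so the game does take place; all other entries are bounded by [follows_admissible]. *)
Lemma follows_meeting (J : {set 'I_K}) (b : R) p1 p2 j a x y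
    (p := p1 ++ (game_clock i0 j, a) :: p2) :
  J \subset C :|: D -> 0 <= b -> (forall j, j \in J -> j \in D -> payS pay <= b) ->
  (forall e, e \in p -> admissible J e) ->
  all_alive x -> b * (size p)%:R < wealth (x i0) -> follows p x y ->
  j \in J :\ i0 -> foldl moved (position (x i0)) p1 = position (x j) ->
  wealth (x j) + (if strat (x j) is Defector then payT pay else payR pay)
    <= wealth (y j) /\
  wealth (x i0) + (if strat (x j) is Defector then - payS pay else payR pay)
    - b * (size p)%:R <= wealth (y i0).
Proof.
move=> JCD b0 bS adm okx bw /follows_cat[z1 [xz1 [u [ua z2y]]]] jJ meet_j.
move: (jJ); rewrite finset.in_setD1 => /andP[ji0 jJ'].
have sp : (size p)%:R = (size p1)%:R + 1 + (size p2)%:R :> R.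
  by rewrite /p size_cat /= addnS -addSn natrD natr1.
have bs1 : 0 <= b * (size p1)%:R by rewrite mulr_ge0.
have bs2 : 0 <= b * (size p2)%:R by rewrite mulr_ge0.
have bsE : b * (size p)%:R = b * (size p1)%:R + b + b * (size p2)%:R by rewrite sp; ring.
have adm1 e : e \in p1 -> admissible J e by move=> ep; apply: adm; rewrite mem_cat ep.
have adm2 e : e \in p2 -> admissible J e.
  by move=> ep; apply: adm; rewrite mem_cat inE ep !orbT.
have [ok1 w1 w1i0 s1 p1E] := follows_admissible JCD b0 bS adm1 okx ltac:(lra) xz1.
have jCD : j \in C :|: D by exact: (fintype.subsetP JCD).
have i0j : i0 != j by rewrite eq_sym.
have ai0 : alive (z1 i0) by apply: alive_in => //; rewrite finset.in_setU i0C.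
have [_ _ _ w2i0 w2j] := update_game u i0j ai0 (alive_in ok1 jCD) (ok1.1 i0 i0C).1.
have admj : admissible J (game_clock i0 j, a).
  by apply: adm; rewrite mem_cat mem_head orbT.
have bz1 : b < wealth (z1 i0) by lra.
have [ok2 w2 w2i0' s2 _] := update_admissible JCD b0 bS admj ua ok1 bz1.
rewrite /= in w2i0' ok2.
have bz2 : b * (size p2)%:R < wealth (update w0 wc pay (game_clock i0 j) u z1 i0) by lra.
have [_ w3 w3i0 _ _] := follows_admissible JCD b0 bS adm2 ok2 bz2 z2y.
have met : meets z1 i0 j by rewrite /meets p1E meet_j (s1 j).2.
rewrite met (s1 j).1 in w2i0 w2j.
have := w3 j ji0 jCD; have := w1 j ji0 jCD; rewrite w2j; split; first lra.
by lra.
Qed.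

(** By the order of [neighbours], direction 0 advances the first coordinate and direction 2 the
    second. Directions attached to games are dummies. *)
Definition cell j : seq (clock K * nat) :=
  [:: (game_clock i0 j, 0%N); (move_clock i0, 0%N)].

Definition torus_row j := flatten (nseq m (cell j)) ++ [:: (move_clock i0, 2%N)].

(* i0 visits the whole torus, and rings the clock of its games with j at
   every site. *)
Definition sweep j := flatten (nseq m (torus_row j)).

Definition sweeps (js : seq 'I_K) := flatten [seq sweep j | j <- js].

Lemma ordS_reach (a b : 'I_m) : exists2 r, (r < m)%N & iter r (@ordS m) a = b.
Proof.
have m0 : (0 < m)%N by apply: leq_trans (ltn_ord a).
have iterE r : val (iter r (@ordS m) a) = ((a + r) %% m)%N.
  elim: r => [|r IHr] /=; first by rewrite addn0 modn_small.
  by rewrite IHr -addn1 modnDml addn1 addnS.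
exists ((b + (m - a)) %% m)%N; first by rewrite ltn_mod.
apply: val_inj; rewrite /= iterE modnDmr addnCA subnKC ?(ltnW (ltn_ord a))//.
by rewrite modnDr modn_small.
Qed.

Lemma foldl_cells j r pos : i0 != j ->
  foldl moved pos (flatten (nseq r (cell j))) = (iter r (@ordS m) pos.1, pos.2).
Proof.
move=> /game_clockP[e [gE _]]; elim: r pos => [|r IHr] pos; first by case: pos.
by rewrite iterSr /= /moved /= gE /= IHr.
Qed.

Lemma foldl_rows j q pos : i0 != j ->
  foldl moved pos (flatten (nseq q (torus_row j))) =
  (iter q (iter m (@ordS m)) pos.1, iter q (@ordS m) pos.2).
Proof.
move=> i0j; elim: q pos => [|q IHq] pos; first by case: pos.
rewrite !iterSr [flatten _]/= foldl_cat IHq /torus_row foldl_cat foldl_cells//.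
Qed.

Lemma nseqD_split (T : Type) (t : T) q n : (q < n)%N ->
  nseq n t = nseq q t ++ t :: nseq (n - q.+1) t.
Proof. by move=> qn; rewrite -cat1s -(nseqD 1) -nseqD add1n subnSK// subnKC// ltnW. Qed.

(** The row q is given by the displacement in the second coordinate, and the cell r by that in the
    first, counted from the start of row q; the sweep is cut at the game entry of that cell. *)
Lemma sweep_meets j pos tgt : i0 != j -> exists p1 p2,
  sweep j = p1 ++ (game_clock i0 j, 0%N) :: p2 /\ foldl moved pos p1 = tgt.
Proof.
move=> i0j; have [q qm qE] := ordS_reach pos.2 tgt.2.
have [r rm rE] := ordS_reach (iter q (iter m (@ordS m)) pos.1) tgt.1.
exists (flatten (nseq q (torus_row j)) ++ flatten (nseq r (cell j))).
exists ((move_clock i0, 0%N) :: flatten (nseq (m - r.+1) (cell j)) ++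
  [:: (move_clock i0, 2%N)] ++ flatten (nseq (m - q.+1) (torus_row j))); split.
  have torus_rowE : torus_row j = flatten (nseq r (cell j)) ++ (game_clock i0 j, 0%N) ::
      (move_clock i0, 0%N) :: flatten (nseq (m - r.+1) (cell j)) ++ [:: (move_clock i0, 2%N)].
    by rewrite /torus_row (nseqD_split _ rm) flatten_cat -catA.
  have -> : sweep j = flatten (nseq q (torus_row j)) ++ torus_row j ++
      flatten (nseq (m - q.+1) (torus_row j)).
    by rewrite /sweep (nseqD_split _ qm) flatten_cat.
  move: (flatten (nseq q _)) (flatten (nseq (m - q.+1) _)) => s1 s2.
  by rewrite torus_rowE -!catA /= -catA.
by rewrite foldl_cat foldl_rows// foldl_cells//= qE rE -surjective_pairing.
Qed.

Lemma sweeps_admissible (J : {set 'I_K}) js e : {subset js <= J :\ i0} ->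
  e \in sweeps js -> admissible J e.
Proof.
move=> jsJ /flattenP[_ /mapP[j /jsJ jJ ->]].
move=> /flattenP[_ /nseqP[-> _]]; rewrite mem_cat => /orP[|].
  move=> /flattenP[_ /nseqP[-> _]]; rewrite !inE => /orP[|] /eqP ->.
    by right; exists j.
  by left.
by rewrite inE => /eqP ->; left.
Qed.

Lemma sweeps_meet js j pos tgt : j \in js -> i0 != j -> exists p1 p2,
  sweeps js = p1 ++ (game_clock i0 j, 0%N) :: p2 /\ foldl moved pos p1 = tgt.
Proof.
move=> jjs i0j; have [js1 [js2 jsE]] : exists js1 js2, js = js1 ++ j :: js2.
  by case/splitPr: jjs => js1 js2; exists js1, js2.
have [p1 [p2 [swE posE]]] := sweep_meets (foldl moved pos (sweeps js1)) tgt i0j.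
exists (sweeps js1 ++ p1), (p2 ++ sweeps js2); split; last by rewrite foldl_cat.
by rewrite jsE /sweeps map_cat flatten_cat /= swE -!catA.
Qed.

Definition coop_sweeps := sweeps (enum (C :\ i0)).
Definition def_sweeps := sweeps (enum (D :\ i0)).
Definition window_pattern := coop_sweeps ++ def_sweeps.

(** No birth clock occurs and every direction of a move is one of the four possible ones. This makes
    all symbols of the pattern have positive probability. *)
Lemma pattern_entry e : e \in window_pattern ->
  (e.1 = move_clock i0 /\ (e.2 < 4)%N) \/
  (exists e' : {e : 'I_K * 'I_K | (e.1 < e.2)%N}, e.1 = inl (inr e')).
Proof.
have game (J : {set 'I_K}) : e \in sweeps (enum (J :\ i0)) ->
    (e.1 = move_clock i0 /\ (e.2 < 4)%N) \/
    (exists e' : {e : 'I_K * 'I_K | (e.1 < e.2)%N}, e.1 = inl (inr e')).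
  move=> ep; have [|//|[j]] := @sweeps_admissible J (enum (J :\ i0)) e _ ep.
  - by move=> j; rewrite mem_enum.
  - by left.
  rewrite finset.in_setD1 eq_sym => /andP[/game_clockP[e' [-> _]] _] ->.
  by right; exists e'.
by rewrite mem_cat => /orP[]; exact: game.
Qed.

Lemma window_pattern_gt0 : (0 < m)%N -> (1 < #|C|)%N -> (0 < size window_pattern)%N.
Proof.
move=> m0 C2; have [j jC] : exists j, j \in C :\ i0.
  by apply/card_gt0P; move: C2; rewrite (cardsD1 i0) i0C.
have i0j : i0 != j by move: jC; rewrite finset.in_setD1 eq_sym => /andP[].
have jenum : j \in enum (C :\ i0) by rewrite mem_enum.
have pos : 'I_m * 'I_m by split; exact: Ordinal m0.
have [p1 [p2 [pE _]]] := sweeps_meet pos pos jenum i0j.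
by rewrite /window_pattern /coop_sweeps pE !size_cat /= addnS.
Qed.

(** Prefixes p1 are needed because survival must hold inside a window too; the gain requires the
    whole phase. A second cooperator is what lets [i0] itself earn R. *)
Lemma coop_phase p1 p2 x y : all_alive x -> coop_sweeps = p1 ++ p2 -> follows p1 x y ->
  [/\ all_alive y, forall k, strat (y k) = strat (x k),
      forall k, k \in C :|: D -> wealth (x k) <= wealth (y k) &
      p2 = [::] -> (1 < #|C|)%N ->
      forall k, k \in C -> wealth (x k) + payR pay <= wealth (y k)].
Proof.
move=> okx cE xy.
have CC : C :\ i0 \subset C :|: D.
  by apply: fintype.subset_trans (finset.subsetUl _ _); exact: finset.subsetDl.
(* C and D are disjoint, as their members have different strategies, so [i0] loses nothing here and
   b = 0 is allowed. *)
have noS j : j \in C :\ i0 -> j \in D -> payS pay <= 0.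
  rewrite finset.in_setD1 => /andP[_ /okx.1[sj _]] /okx.2[].
  by rewrite sj.
have adm e : e \in coop_sweeps -> admissible (C :\ i0) e.
  apply: sweeps_admissible => j; rewrite mem_enum !finset.in_setD1 => /andP[-> ->].
  by [].
have adm1 e : e \in p1 -> admissible (C :\ i0) e.
  by move=> ep; apply: adm; rewrite cE mem_cat ep.
have wx0 : 0 * (size p1)%:R < wealth (x i0) by rewrite mul0r (okx.1 i0 i0C).2.
have [oky wy wyi0 sy _] := follows_admissible CC (lexx 0) noS adm1 okx wx0 xy.
split=> //; first by move=> k; rewrite (sy k).1.
  move=> k kCD; have [->|ki0] := eqVneq k i0; last exact: wy.
  by rewrite mul0r subr0 in wyi0.
move=> p20 C2; rewrite p20 cats0 in cE.
have gain j : j \in C :\ i0 -> wealth (x j) + payR pay <= wealth (y j) /\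
    wealth (x i0) + payR pay <= wealth (y i0).
  move=> jC; have i0j : i0 != j by move: jC; rewrite finset.in_setD1 eq_sym => /andP[].
  have jenum : j \in enum (C :\ i0) by rewrite mem_enum.
  have [q1 [q2 [qE qpos]]] := sweeps_meet (position (x i0)) (position (x j)) jenum i0j.
  have sj : strat (x j) = Cooperator.
    by move: jC; rewrite finset.in_setD1 => /andP[_ /okx.1[]].
  rewrite -cE /coop_sweeps qE in adm1 wx0 xy.
  have jC2 : j \in (C :\ i0) :\ i0 by rewrite finset.in_setD1 eq_sym i0j.
  have := follows_meeting CC (lexx 0) noS adm1 okx wx0 xy jC2 qpos.
  by rewrite sj mul0r subr0.
move=> k kC; have [->|ki0] := eqVneq k i0; last first.
  by apply: (gain k _).1; rewrite finset.in_setD1 ki0.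
have [j jC] : exists j, j \in C :\ i0.
  by apply/card_gt0P; move: C2; rewrite (cardsD1 i0) i0C.
exact: (gain j jC).2.
Qed.

Lemma def_phase p1 p2 x y : all_alive x -> def_sweeps = p1 ++ p2 -> follows p1 x y ->
  payS pay * (size def_sweeps)%:R < wealth (x i0) ->
  [/\ all_alive y, forall k, strat (y k) = strat (x k),
      forall k, k != i0 -> k \in C :|: D -> wealth (x k) <= wealth (y k),
      wealth (x i0) - payS pay * (size p1)%:R <= wealth (y i0) &
      p2 = [::] -> forall k, k \in D -> wealth (x k) + payT pay <= wealth (y k)].
Proof.
move=> okx cE xy wx0.
have DD : D :\ i0 \subset C :|: D.
  by apply: fintype.subset_trans (finset.subsetUr _ _); exact: finset.subsetDl.
have noS j : j \in D :\ i0 -> j \in D -> payS pay <= payS pay by [].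
have adm e : e \in def_sweeps -> admissible (D :\ i0) e.
  apply: sweeps_admissible => j; rewrite mem_enum !finset.in_setD1 => /andP[-> ->].
  by [].
have adm1 e : e \in p1 -> admissible (D :\ i0) e.
  by move=> ep; apply: adm; rewrite cE mem_cat ep.
have S0 := ltW payS_gt0.
have wx1 : payS pay * (size p1)%:R < wealth (x i0).
  apply: le_lt_trans wx0; rewrite ler_wpM2l// ler_nat cE size_cat leq_addr//.
have [oky wy wyi0 sy _] := follows_admissible DD S0 noS adm1 okx wx1 xy.
split=> //; first by move=> k; rewrite (sy k).1.
move=> p20 j jD; rewrite p20 cats0 in cE.
have sj := (okx.2 j jD).1.
have ji0 : j != i0.
  by apply/eqP => ji0; move: sj; rewrite ji0 (okx.1 i0 i0C).1.
have i0j : i0 != j by rewrite eq_sym.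
have jenum : j \in enum (D :\ i0) by rewrite mem_enum finset.in_setD1 ji0.
have [q1 [q2 [qE qpos]]] := sweeps_meet (position (x i0)) (position (x j)) jenum i0j.
rewrite -cE /def_sweeps qE in adm1 wx1 xy.
have jD2 : j \in (D :\ i0) :\ i0 by rewrite !finset.in_setD1 ji0.
have [] := follows_meeting DD S0 noS adm1 okx wx1 xy jD2 qpos.
by rewrite sj.
Qed.

(** Whatever positive wealth [i0] starts with, the R earned in the first phase exceeds S times the
    length of the second, so it survives every prefix. *)
Lemma window_phase p1 p2 x y : all_alive x -> window_pattern = p1 ++ p2 ->
  follows p1 x y -> (1 < #|C|)%N -> payS pay * (size window_pattern)%:R < payR pay ->
  [/\ all_alive y, forall k, strat (y k) = strat (x k) &
      p2 = [::] ->
      (forall k, k \in C ->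
        wealth (x k) + payR pay - payS pay * (size window_pattern)%:R <= wealth (y k)) /\
      (forall k, k \in D -> wealth (x k) + payT pay <= wealth (y k))].
Proof.
move=> okx wE xy C2 SR; have S0 := ltW payS_gt0.
have size_le : payS pay * (size def_sweeps)%:R <= payS pay * (size window_pattern)%:R.
  by rewrite ler_wpM2l// ler_nat size_cat leq_addl.
have [p1_ge|p1_lt] := leqP (size coop_sweeps) (size p1); last first.
  have cE : coop_sweeps = p1 ++ drop (size p1) coop_sweeps.
    rewrite -{1}(cat_take_drop (size p1) coop_sweeps); congr (_ ++ _).
    have := congr1 (take (size p1)) wE.
    by rewrite take_size_cat// /window_pattern takel_cat// ltnW.
  (* Such a prefix ends before the cooperator phase does, so p2 cannot be empty. *)
  have [oky sy _ _] := coop_phase okx cE xy; split=> // p20.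
  move: p1_lt; rewrite -[size p1]addn0 -[X in (_ + X)%N](congr1 size p20).
  by rewrite -size_cat -wE size_cat ltnNge leq_addr.
have pE : p1 = coop_sweeps ++ drop (size coop_sweeps) p1.
  rewrite -{1}(cat_take_drop (size coop_sweeps) p1); congr (_ ++ _).
  have := congr1 (take (size coop_sweeps)) wE.
  by rewrite /window_pattern (take_size_cat _ (erefl _)) takel_cat// => /esym.
have dE : def_sweeps = drop (size coop_sweeps) p1 ++ p2.
  have := congr1 (drop (size coop_sweeps)) wE.
  by rewrite {1}pE -catA /window_pattern !(drop_size_cat _ (erefl _)).
move: xy; rewrite pE => /follows_cat[z [xz zy]].
have [okz sz wz gain] := coop_phase okx (esym (cats0 _)) xz.
have {}gain := gain erefl C2.
have wz0 : payS pay * (size def_sweeps)%:R < wealth (z i0).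
  have := gain i0 i0C; have := (okx.1 i0 i0C).2; lra.
have [oky sy wy wyi0 gainD] := def_phase okz dE zy wz0.
split=> //; first by move=> k; rewrite sy sz.
move=> p20; split=> k kCD.
  have [->|ki0] := eqVneq k i0.
    have gain0 := gain i0 i0C.
    have le_d : payS pay * (size (drop (size coop_sweeps) p1))%:R <=
        payS pay * (size def_sweeps)%:R.
      by rewrite ler_wpM2l// ler_nat dE size_cat leq_addr.
    by lra.
  have wyk : wealth (z k) <= wealth (y k) by apply: wy; rewrite // finset.in_setU kCD.
  have gaink := gain k kCD.
  have : 0 <= payS pay * (size window_pattern)%:R by rewrite mulr_ge0.
  by lra.
have := gainD p20 k kCD; apply: le_trans; rewrite lerD2r.
by apply: wz; rewrite finset.in_setU kCD orbT.
Qed.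

End patterns.

(** * Survival along a path *)

Section paths.
Context (R : realType) (m K : nat) (w0 wc : R) (pay : payoffs R)
  (N : clock K -> R -> nat) (V : clock K -> nat -> R) (x : R -> config R m K).
Hypothesis payR_gt0 : 0 < payR pay.
Hypothesis payT_gt0 : 0 < payT pay.
Hypothesis payS_gt0 : 0 < payS pay.
Hypothesis payP_gt0 : 0 < payP pay.
Hypothesis w0_gt0 : 0 < w0.
Hypothesis N_le : forall c s t, 0 <= s -> s <= t -> (N c s <= N c t)%N.
Hypothesis x_const : forall s t, 0 <= s -> s <= t ->
  (forall c, N c t = N c s) -> x t = x s.
Hypothesis x_jump : forall s t c, 0 <= s -> s <= t -> N c t = (N c s).+1 ->
  (forall c', c' != c -> N c' t = N c' s) ->
  x t = update w0 wc pay c (V c (N c s)) (x s).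
Hypothesis sparse : forall n, exists k, forall j, (j < k.+1)%N ->
  (\sum_c (N c (n%:R + j.+1%:R / k.+1%:R) - N c (n%:R + j%:R / k.+1%:R)) <= 1)%N.

Definition total_rings (t : R) : nat := (\sum_c N c t)%N.

Lemma sum_rings s t : 0 <= s -> s <= t ->
  (\sum_c (N c t - N c s))%N = (total_rings t - total_rings s)%N.
Proof. by move=> s0 st; rewrite sumnB// => c _; exact: N_le. Qed.

Lemma total_le s t : 0 <= s -> s <= t -> (total_rings s <= total_rings t)%N.
Proof. by move=> s0 st; apply: leq_sum => c _; exact: N_le. Qed.

Lemma total_eq s t : 0 <= s -> s <= t -> (total_rings t <= total_rings s)%N ->
  forall c, N c t = N c s.
Proof.
move=> s0 st ts c; apply/eqP; rewrite eqn_leq (N_le _ s0 st) andbT.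
rewrite leqNgt; apply/negP => lt_c; move: ts; rewrite leqNgt => /negP; apply.
rewrite /total_rings (bigD1 c)//= [ltnRHS](bigD1 c)//= -addSn leq_add//.
by apply: leq_sum => c' _; exact: N_le.
Qed.

(** These two cases are exactly those in which [x_const] and [x_jump] determine the
    configuration. *)
Lemma one_ring s t : 0 <= s -> s <= t -> (total_rings t <= (total_rings s).+1)%N ->
  (forall c, N c t = N c s) \/
  exists c, [/\ total_rings t = (total_rings s).+1, N c t = (N c s).+1 &
    forall c', c' != c -> N c' t = N c' s].
Proof.
move=> s0 st; rewrite leq_eqVlt => /orP[/eqP ts|]; last by left; exact: total_eq.
right; have [c cr] : exists c, (N c s < N c t)%N.
  apply/existsP; apply: contra_eqT ts => /existsPn no.
  rewrite ltn_eqF// ltnS; apply: leq_sum => c _.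
  by rewrite leqNgt; exact: no.
have rest c' : c' != c -> (N c' s <= N c' t)%N by move=> _; exact: N_le.
have : (\sum_(c' | c' != c) N c' t <= \sum_(c' | c' != c) N c' s)%N.
  rewrite -(leq_add2l (N c s).+1) [leqRHS]addSn.
  apply: (@leq_trans (N c t + \sum_(c' | c' != c) N c' t)); first by rewrite leq_add2r.
  by move: ts; rewrite /total_rings (bigD1 c)//= [in RHS](bigD1 c)//= => ->.
move=> le_rest; have eq_rest c' : c' != c -> N c' t = N c' s.
  move=> c'c; apply/eqP; rewrite eqn_leq (N_le _ s0 st) andbT.
  rewrite leqNgt; apply/negP => lt_c; move: le_rest; rewrite leqNgt => /negP; apply.
  rewrite (bigD1 c')//= [ltnRHS](bigD1 c')//= -addSn leq_add//.
  by apply: leq_sum => c'' _; exact: N_le.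
exists c; split=> //.
move: ts; rewrite /total_rings (bigD1 c)//= [in RHS](bigD1 c)//=.
by rewrite (eq_bigr _ eq_rest) -addSn => /addIn.
Qed.

(** A bound linear in the number of rings, so that it composes over successive time intervals. *)
Definition evolves (s t : R) : Prop := forall i, is_born (strat (x s i)) ->
  strat (x t i) = strat (x s i) /\
  reserve w0 (x s) i - max_loss pay (strat (x s i)) * ((total_rings t)%:R - (total_rings s)%:R)
    <= reserve w0 (x t) i.

Lemma evolves_trans s t r : evolves s t -> evolves t r -> evolves s r.
Proof.
move=> st tr i bi; have [sti wti] := st i bi.
have [sri wri] := tr i ltac:(by rewrite sti).
rewrite sti in sri wri; split=> //.
by move: (max_loss _ _) wti wri => l wti wri; lra.
Qed.

Lemma evolves_one s t : 0 <= s -> s <= t -> (total_rings t <= (total_rings s).+1)%N -> evolves s t.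
Proof.
move=> s0 st ts i bi; have [same|[c [tsE cE others]]] := one_ring s0 st ts.
  rewrite (x_const s0 st same); split=> //.
  have -> : total_rings t = total_rings s by apply: eq_bigr => c _; exact: same.
  by rewrite subrr mulr0 subr0.
rewrite (x_jump s0 st cE others); split; first exact: update_strat.
have -> : (total_rings t)%:R - (total_rings s)%:R = 1 :> R by rewrite tsE -natr1; ring.
rewrite mulr1.
by apply: update_reserve; rewrite ?ltW.
Qed.

(** Each cell of the grid from [sparse], and hence its part up to t, contains at most one ring; the
    single-ring bounds are then chained. *)
Lemma evolves_unit n t : n%:R <= t -> t <= n.+1%:R -> evolves n%:R t.
Proof.
move=> nt tn; have [k sparse_k] := sparse n.
pose g j : R := n%:R + j%:R / k.+1%:R.
have g0 j : 0 <= g j by rewrite addr_ge0// divr_ge0.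
have g_le j : g j <= g j.+1 by rewrite lerD2l ler_pM2r ?ler_nat// invr_gt0.
suff : forall j, (j <= k.+1)%N -> forall t, n%:R <= t -> t <= g j -> evolves n%:R t.
  apply; [exact: leqnn|exact: nt|].
  by rewrite /g divff ?pnatr_eq0// natr1.
elim=> [_|j IHj jk] {nt tn}{}t nt tg.
  have -> : t = n%:R by apply/eqP; rewrite eq_le nt andbT; rewrite /g mul0r addr0 in tg.
  by move=> i bi; rewrite subrr mulr0 subr0.
have [tgj|gjt] := leP t (g j); first by apply: IHj => //; exact: ltnW.
apply: (@evolves_trans _ (g j)).
  by apply: IHj; [exact: ltnW|rewrite lerDl divr_ge0|exact: lexx].
apply: evolves_one => //; first exact: ltW.
rewrite -[leqRHS]addn1 -leq_subLR; apply: leq_trans (sparse_k j jk).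
rewrite sum_rings//; last exact: g_le.
by apply: leq_sub2r; apply: total_le => //; exact: ltW (le_lt_trans (g0 j) gjt).
Qed.

Lemma evolves_from_nat n t : n%:R <= t -> evolves n%:R t.
Proof.
move=> nt; suff : forall k t, n%:R <= t -> t <= (n + k)%:R -> evolves n%:R t.
  move=> /(_ (Num.truncn t).+1 t nt); apply.
  by rewrite natrD; apply: (le_trans (ltW (truncnS_gt t))); rewrite lerDr.
elim=> [|k IHk] {nt}{}t nt.
  rewrite addn0 => tn; have -> : t = n%:R by apply/eqP; rewrite eq_le nt andbT.
  by move=> i bi; rewrite subrr mulr0 subr0.
rewrite addnS => tk; have [tnk|nkt] := leP t (n + k)%:R; first exact: IHk.
apply: (@evolves_trans _ (n + k)%:R); first by apply: IHk; rewrite // ler_nat leq_addr.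
by apply: evolves_unit => //; exact: ltW.
Qed.

Context (C D : {set 'I_K}) (i0 : 'I_K).
Hypothesis i0C : i0 \in C.
Hypothesis C2 : (1 < #|C|)%N.
Hypothesis alive0 : all_alive C D (x 0).

Local Notation pat := (window_pattern m C D i0).
Local Notation H := (size pat).
Hypothesis H_gt0 : (0 < H)%N.

Definition perfect_window (n : nat) : Prop :=
  forall r e, (r < H)%N -> e = nth (move_clock i0, 0%N) pat r ->
  (forall c, N c (n * H + r).+1%:R - N c (n * H + r)%:R = (c == e.1))%N /\
  (e.1 = move_clock i0 -> direction (V e.1 (N e.1 (n * H + r)%:R)) = e.2).

Lemma perfect_follows n r : perfect_window n -> (r <= H)%N ->
  follows w0 wc pay (take r pat) (x (n * H)%:R) (x (n * H + r)%:R).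
Proof.
move=> perf; elim: r => [_|r IHr rH]; first by rewrite take0 addn0.
rewrite (take_nth (move_clock i0, 0%N))//.
case E : (nth _ _ r) => [c a]; apply/follows_rcons.
exists (x (n * H + r)%:R); split; first by apply: IHr; exact: ltnW.
have [ringE dirE] := perf r (c, a) rH (esym E).
exists (V c (N c (n * H + r)%:R)); split.
  have /pattern_entry[] : (c, a) \in pat by rewrite -E mem_nth.
    by move=> [cE _]; rewrite /= in cE; move: (dirE cE); rewrite cE.
  by move=> [e]; rewrite /= => ->.
have le_t : (n * H + r)%:R <= (n * H + r).+1%:R :> R by rewrite ler_nat.
have step c' : N c' (n * H + r).+1%:R = (N c' (n * H + r)%:R + (c' == c))%N.
  by rewrite -(ringE c') subnKC// N_le.
rewrite addnS; apply: x_jump => //; first by rewrite step eqxx addn1.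
by move=> c' /negbTE c'c; rewrite step c'c addn0.
Qed.

Lemma perfect_total n r : perfect_window n -> (r <= H)%N ->
  total_rings (n * H + r)%:R = (total_rings (n * H)%:R + r)%N.
Proof.
move=> perf; elim: r => [_|r IHr rH]; first by rewrite !addn0.
have [ringE _] := perf r _ rH erefl.
have t0 : 0 <= (n * H + r)%:R :> R by [].
have le_t : (n * H + r)%:R <= (n * H + r).+1%:R :> R by rewrite ler_nat.
have := sum_rings t0 le_t.
rewrite (eq_bigr _ (fun c _ => ringE c)) (bigD1 (nth (move_clock i0, 0%N) pat r).1)//=.
rewrite eqxx big1 ?addn0; last by move=> c /negbTE ->.
rewrite !addnS -IHr ?(ltnW rH)// => /(congr1 (addn (total_rings (n * H + r)%:R))).
by rewrite subnKC ?total_le// addn1.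
Qed.

Lemma all_alive_evolves s t : all_alive C D (x s) -> evolves s t ->
  (forall i, i \in C -> 0 < reserve w0 (x s) i -
    payS pay * ((total_rings t)%:R - (total_rings s)%:R)) ->
  (forall i, i \in D -> 0 < reserve w0 (x s) i -
    2 * payP pay * ((total_rings t)%:R - (total_rings s)%:R)) ->
  all_alive C D (x t).
Proof.
move=> oks st wC wD.
have reserve_le i : reserve w0 (x t) i <= wealth (x t i).
  by rewrite gerBl mulr_ge0// ltW.
split=> i iCD.
  have [si _] := oks.1 i iCD; have [] := st i ltac:(by rewrite si).
  rewrite si => -> wi; split=> //; apply: lt_le_trans (reserve_le i).
  by apply: lt_le_trans wi; exact: wC.
have [si _] := oks.2 i iCD; have [] := st i ltac:(by rewrite si).
rewrite si => -> wi; split=> //; apply: lt_le_trans (reserve_le i).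
by apply: lt_le_trans wi; exact: wD.
Qed.

(** A unit interval of a perfect window contains one ring, so at any time inside it the
    configuration is that of one of its two end points, both reached by prefixes of the pattern. *)
Lemma perfect_alive n t : perfect_window n -> all_alive C D (x (n * H)%:R) ->
  payS pay * H%:R < payR pay -> (n * H)%:R <= t -> t <= (n.+1 * H)%:R ->
  all_alive C D (x t).
Proof.
move=> perf okn SH nt tn.
have phase r : (r <= H)%N -> all_alive C D (x (n * H + r)%:R).
  move=> rH; have [] := @window_phase R m K w0 wc pay C D i0 i0C payR_gt0 payT_gt0 payS_gt0
    (take r pat) (drop r pat) (x (n * H)%:R) (x (n * H + r)%:R) okn _
    (perfect_follows perf rH) C2 SH => //.
  by rewrite cat_take_drop.
have [->|tlt] := eqVneq t (n.+1 * H)%:R; first by rewrite mulSnr; exact: phase.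
have {tlt}tn : t < (n.+1 * H)%:R by rewrite lt_neqAle tlt.
have t0 : 0 <= t by apply: le_trans nt.
have /andP[kt tk] := truncn_itv t0; set k := Num.truncn t in kt tk.
have nk : (n * H <= k)%N by rewrite truncn_ge_nat.
have kn : (k < n.+1 * H)%N by rewrite -(ltr_nat R); exact: le_lt_trans tn.
pose r := (k - n * H)%N; have kE : k = (n * H + r)%N by rewrite subnKC.
have rH : (r < H)%N by rewrite ltn_subLR// -mulSnr.
have k1 := perfect_total perf rH; have k2 := perfect_total perf (ltnW rH).
rewrite addnS -kE in k1; rewrite -kE in k2.
have tt : (total_rings t <= (total_rings k%:R).+1)%N.
  by rewrite k2 -addnS -k1; apply: total_le => //; exact: ltW.
have [same|[c [ttE _ _]]] := one_ring (ler0n _ k) kt tt.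
  by rewrite (x_const _ kt same)// kE; exact: phase (ltnW rH).
rewrite -(@x_const t k.+1%:R t0 (ltW tk)).
  by rewrite kE -addnS; exact: phase.
by apply: total_eq; rewrite ?(ltW tk)// k1 ttE k2 addnS.
Qed.

(** Induction on windows, with W the number of perfect ones so far: a reserve is at least its
    initial value plus R W minus S times the rings for cooperators, and likewise with T and 2P for
    defectors. A perfect window adds H rings and one unit to W; in any other window, [good] keeps
    the reserves positive. *)
Lemma window_survival (nu : R) (perfectb : nat -> bool) :
  (forall n, perfectb n -> perfect_window n) ->
  (forall n, perfectb n \/
    (total_rings (n.+1 * H)%:R + K)%N%:R <= nu * (\sum_(k < n) perfectb k)%N%:R) ->
  total_rings 0 = 0%N -> H%:R <= nu ->
  nu * (payS pay + w0) < payR pay -> nu * (2 * payP pay + w0) < payT pay ->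
  forall t, 0 <= t -> all_alive C D (x t).
Proof.
move=> perfE good total0 nuH nuR nuT.
pose W n : R := (\sum_(k < n) perfectb k)%N%:R.
have WS n : W n.+1 = W n + (perfectb n)%:R by rewrite /W big_ord_recr natrD.
have W0 n : 0 <= W n by [].
have nu0 : 0 <= nu by apply: le_trans nuH.
(* H <= nu turns the hypothesis on R into the condition for surviving a single perfect window. *)
have SH : payS pay * H%:R < payR pay.
  apply: le_lt_trans nuR; rewrite mulrC ler_pM//; first exact: ltW.
  by rewrite lerDl ltW.
have S0 := ltW payS_gt0; have P0 := ltW payP_gt0; have w00 := ltW w0_gt0.
have PP0 : 0 <= 2 * payP pay by rewrite mulr_ge0.
have reserve0 i : i \in C :|: D -> - (w0 * K%:R) < reserve w0 (x 0) i.
  move=> /(alive_in alive0) /andP[_ wi].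
  have : w0 * (unborn_count (x 0))%:R <= w0 * K%:R.
    by rewrite ler_wpM2l// ler_nat unborn_count_le.
  by rewrite /reserve; lra.
suff claim n : (forall t, 0 <= t -> t <= (n * H)%:R -> all_alive C D (x t)) /\
    (forall i, i \in C -> reserve w0 (x 0) i + payR pay * W n -
        payS pay * (total_rings (n * H)%:R)%:R <= reserve w0 (x (n * H)%:R) i) /\
    (forall i, i \in D -> reserve w0 (x 0) i + payT pay * W n -
        2 * payP pay * (total_rings (n * H)%:R)%:R <= reserve w0 (x (n * H)%:R) i).
  move=> t t0; apply: (claim (Num.truncn t).+1).1 => //.
  apply: (le_trans (ltW (truncnS_gt t))); rewrite ler_nat leq_pmulr//.
elim: n => [|n [aliven [wC wD]]].
  rewrite mul0n total0 /W big_ord0 !mulr0.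
  split; first by move=> t t0 t_le0; have -> : t = 0 by apply/eqP; rewrite eq_le t0 t_le0.
  by split=> i _; rewrite addr0 subr0.
have okn : all_alive C D (x (n * H)%:R) by apply: aliven.
have alive_window : (forall t, (n * H)%:R <= t -> t <= (n.+1 * H)%:R -> all_alive C D (x t)) ->
    forall t, 0 <= t -> t <= (n.+1 * H)%:R -> all_alive C D (x t).
  move=> win t t0 tn; have [tle|tgt] := leP t (n * H)%:R; first exact: aliven.
  by apply: win => //; exact: ltW.
have nHle : (n * H)%:R <= (n.+1 * H)%:R :> R by rewrite ler_nat leq_mul2r leqnSn orbT.
have [perf|nperf] := boolP (perfectb n).
  have perfn := perfE n perf.
  split; first by apply: alive_window => t; exact: perfect_alive.
  have [_ sE gain] := @window_phase R m K w0 wc pay C D i0 i0C payR_gt0 payT_gt0 payS_gt0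
    pat [::] (x (n * H)%:R) (x (n.+1 * H)%:R) okn (esym (cats0 _))
    ltac:(by have := perfect_follows perfn (leqnn H); rewrite take_size -mulSnr) C2 SH.
  have [gainC gainD] := gain erefl.
  have uE : unborn_count (x (n.+1 * H)%:R) = unborn_count (x (n * H)%:R).
    exact: eq_unborn_count.
  have tE := perfect_total perfn (leqnn H); rewrite -mulSnr in tE.
  rewrite WS perf /= tE natrD; split=> i iCD.
    have := wC i iCD; have := gainC i iCD; rewrite /reserve uE; lra.
  have := wD i iCD; have := gainD i iCD; rewrite /reserve uE.
  have : 0 <= 2 * payP pay * H%:R by rewrite mulr_ge0.
  by lra.
have [|bound] := good n; first by rewrite (negbTE nperf).
rewrite -/(W n) natrD in bound.
(* The origin of the sums S + w0 and 2P + w0: (l + w0)(rings + K) dominates both the losses l per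
   ring and the births, worth w0 K. Strict positivity then comes from [reserve0]. *)
have growth (g l : R) : 0 <= l -> nu * (l + w0) < g ->
    l * (total_rings (n.+1 * H)%:R)%:R + w0 * K%:R <= g * W n.
  move=> l0 nug; apply: (@le_trans _ _ (nu * (l + w0) * W n)).
    apply: (@le_trans _ _ ((l + w0) * (nu * W n))); last by rewrite mulrCA mulrA.
    apply: (@le_trans _ _ ((l + w0) * ((total_rings (n.+1 * H)%:R)%:R + K%:R))); last first.
      by rewrite ler_wpM2l// addr_ge0.
    have : 0 <= l * K%:R by rewrite mulr_ge0.
    have : 0 <= w0 * (total_rings (n.+1 * H)%:R)%:R by rewrite mulr_ge0.
    by nra.
  by rewrite ler_wpM2r// ltW.
have growC := growth _ _ S0 nuR; have growD := growth _ _ PP0 nuT.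
split.
  apply: alive_window => t nt tn.
  have tt : (total_rings t)%:R <= (total_rings (n.+1 * H)%:R)%:R :> R.
    by rewrite ler_nat total_le// (le_trans _ nt).
  apply: (all_alive_evolves okn (evolves_from_nat nt)) => i iCD.
    have := wC i iCD; have := reserve0 i ltac:(by rewrite finset.in_setU iCD).
    have : payS pay * (total_rings t)%:R <= payS pay * (total_rings (n.+1 * H)%:R)%:R.
      by rewrite ler_wpM2l.
    by lra.
  have := wD i iCD; have := reserve0 i ltac:(by rewrite finset.in_setU iCD orbT).
  have : 2 * payP pay * (total_rings t)%:R <= 2 * payP pay * (total_rings (n.+1 * H)%:R)%:R.
    by rewrite ler_wpM2l.
  by lra.
rewrite WS (negbTE nperf) addr0.
have ev := evolves_from_nat nHle.
split=> i iCD.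
  have si := (okn.1 i iCD).1; have [_] := ev i ltac:(by rewrite si).
  by rewrite si /=; have := wC i iCD; lra.
have si := (okn.2 i iCD).1; have [_] := ev i ltac:(by rewrite si).
by rewrite si /=; have := wD i iCD; lra.
Qed.

End paths.

(** * Survival with positive probability *)

(* The paths are right-continuous, so that rational times suffice. *)
Lemma measurable_survival (R : realType) (m K : nat) (s0 : config R m K)
    (C : finType) (disp : measure_display) (Omega : measurableType disp)
    (N : C -> R -> Omega -> nat) (st : R -> Omega -> config R m K) :
  (forall t i, 0 <= t -> measurable_fun setT (fun omega => wealth (st t omega i))) ->
  (forall c omega t, 0 <= t -> \forall s \near t^'+, N c s omega = N c t omega) ->
  (forall omega s t, 0 <= s -> s <= t ->
    (forall c, N c t omega = N c s omega) -> st t omega = st s omega) ->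
  measurable (survival s0 st).
Proof.
move=> mst right_cont st_const.
pose F (q : rat) (i : 'I_K) : set Omega :=
  if (0 <= ratr q :> R) && alive (s0 i) then [set omega | 0 < wealth (st (ratr q) omega i)]
  else setT.
have -> : survival s0 st = ~` \bigcup_q ~` (\bigcap_(i in [set: 'I_K]) F q i).
  rewrite setC_bigcup; under eq_bigcapr do rewrite setCK.
  apply/seteqP; split=> omega.
    by move=> surv q _ i _; rewrite /F; case: ifP => // /andP[q0 ai]; exact: surv.
  move=> FE t i t0 ai.
  have near_t : \forall s \near t^'+, forall c, N c s omega = N c t omega.
    by apply: filter_forall => c; exact: right_cont.
  have [e /= e0 te] : exists2 e : R, 0 < e & forall s, t < s -> s < t + e ->
      forall c, N c s omega = N c t omega.
    have /nbhs_ballP[e /= e0 te] :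
        nbhs t [set s | t < s -> forall c, N c s omega = N c t omega] := near_t.
    exists e => // s ts se.
    by apply: te => //; rewrite /ball /= ltr0_norm ?subr_lt0// opprB ltrBlDl.
  have [q /andP[]] : exists q : rat, t < ratr q < t + e.
    have [q] := rat_in_itvoo (ltr_pwDr e0 (lexx t)).
    by rewrite in_itv /=; exists q.
  move=> tq qe; rewrite -(st_const omega t (ratr q) t0 (ltW tq)); last exact: te.
  have := FE q I i I; rewrite /F ai (le_trans t0 (ltW tq)).
  exact.
apply: measurableC; apply: bigcupT_measurable_rat => q; apply: measurableC.
apply: fin_bigcap_measurable => // i _; rewrite /F; case: ifP => // /andP[q0 _].
have -> : [set omega | 0 < wealth (st (ratr q) omega i)] =
    (fun omega => wealth (st (ratr q) omega i)) @^-1` `]0, +oo[%classic.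
  by apply/seteqP; split=> omega /=; rewrite in_itv /= andbT.
by rewrite -[_ @^-1` _]setTI; exact: mst.
Qed.

(** What a perfect unit interval records: a single ring, and a direction only when the ring is a
    move of [i0]. *)
Definition pattern_symbol (K : nat) (i0 : 'I_K) (e : clock K * nat) :
    {ffun clock K -> nat} * seq nat :=
  ([ffun c => (c == e.1 : nat)], if e.1 == move_clock i0 then [:: e.2] else [::]).

Lemma pattern_symbol_gt0 (R : realType) (m K : nat) (rates : clock K -> R)
    (C D : {set 'I_K}) (i0 : 'I_K) : (forall c, 0 < rates c) ->
  0 < \prod_(s <- [seq pattern_symbol i0 e | e <- window_pattern m C D i0])
    symbol_prob rates (move_clock i0) s.
Proof.
move=> rates0; rewrite big_map big_seq; apply: prodr_gt0 => e /pattern_entry eE.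
have sizeE : size (pattern_symbol i0 e).2 == (pattern_symbol i0 e).1 (move_clock i0).
  by rewrite /= ffunE [_ == e.1]eq_sym; case: ifP.
rewrite /symbol_prob sizeE; apply: mulr_gt0.
  apply: prodr_gt0 => c _; rewrite ffunE /poisson_pmf rates0.
  by rewrite !mulr_gt0 ?exprn_gt0 ?expR_gt0 ?invr_gt0 ?ltr0n ?fact_gt0.
rewrite /=; case: eqP => [e1|_]; last by rewrite big_nil.
rewrite big_seq1; apply: direction_prob_gt0.
by case: eE => [[]//|[e']]; rewrite e1.
Qed.

Lemma rate_gt0 (R : realType) (K : nat) (d v b : R) (c : clock K) :
  0 < d -> 0 < v -> 0 < b -> 0 < rate d v b c.
Proof. by case: c => [[]|]. Qed.

Lemma mutually_independent_inl (disp : measure_display)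
    (Omega : measurableType disp) (R : realType) (P : probability Omega R)
    (I J : eqType) (F : I + J -> set (set Omega)) :
  mutually_independent P F -> mutually_independent P (fun i => F (inl i)).
Proof.
move=> indep s A us FA.
pose A' (a : I + J) := if a is inl i then A i else setT.
have -> : \bigcap_(i in [set` s]) A i = \bigcap_(a in [set` map inl s]) A' a.
  apply/seteqP; split=> omega sA; first by move=> _ /mapP[i is_ ->]; exact: sA.
  by move=> i is_; apply: (sA (inl i)); rewrite /= map_f.
rewrite indep ?big_map//; first by rewrite map_inj_uniq// => i j [].
by move=> _ /mapP[i is_ ->]; exact: FA.
Qed.

Lemma perfect_window_symbols (R : realType) (m K : nat) (disp : measure_display)
    (Omega : measurableType disp) (P : probability Omega R)
    (N : clock K -> R -> Omega -> nat) (U : clock K -> nat -> {RV P >-> R})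
    (C D : {set 'I_K}) (i0 : 'I_K) (n : nat) (omega : Omega)
    (pat := window_pattern m C D i0) :
  window N U (move_clock i0) (size pat) n omega =
    [seq pattern_symbol i0 e | e <- pat] ->
  @perfect_window R m K (fun c t => N c t omega) (fun c k => U c k omega) C D i0 n.
Proof.
move=> winE r e rH eE.
have : unit_symbol N U (move_clock i0) (n * size pat + r) omega = pattern_symbol i0 e.
  have := congr1 (nth (pattern_symbol i0 (move_clock i0, 0%N)) ^~ r) winE.
  by rewrite /= nth_mkseq// (nth_map (move_clock i0, 0%N))// -eE.
move=> [ringsE dirE]; have ringE c : unit_rings (N c) (n * size pat + r) omega = (c == e.1).
  by move/ffunP/(_ c): ringsE; rewrite !ffunE.
split; first exact: ringE.
by move=> e1; move: dirE; rewrite ringE e1 eqxx /= /mkseq /= addn0 => -[].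
Qed.

Theorem theorem2p3 (R : realType) (m K : nat) (d v b w0 wc : R)
    (m_ge1 : (1 <= m)%N) (K_ge1 : (1 <= K)%N)
    (d_gt0 : 0 < d) (v_gt0 : 0 < v) (b_gt0 : 0 < b)
    (w0_gt0 : 0 < w0) (w0_lt_wc : w0 < wc) :
  exists nu nu' : R, [/\ 0 < nu, 0 < nu' &
    forall pay : payoffs R,
      0 < payR pay -> payR pay < payT pay ->
      0 < payP pay -> payP pay < payS pay ->
      nu * (payS pay + w0) < payR pay ->
      nu' * (2 * payP pay + w0) < payT pay ->
    forall s0 : config R m K,
      (2 <= #|[pred i | is_coop (strat (s0 i)) && (0 < wealth (s0 i))%R]|)%N ->
      (1 <= #|[pred i | is_def (strat (s0 i)) && (0 < wealth (s0 i))%R]|)%N ->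
    forall (disp : measure_display) (Omega : measurableType disp)
      (P : probability Omega R) (st : R -> Omega -> config R m K),
      DPD_process d v b w0 wc pay s0 P st ->
      (0 < P (survival s0 st))%E].
Proof.
have rates0 c : 0 < rate d v b c := @rate_gt0 R K d v b c d_gt0 v_gt0 b_gt0.
(* The pattern depends on the initial configuration only through the triple (i0, C, D), which ranges
   over a finite type. So [nu] can be chosen for all triples at once. *)
pose pat (tau : 'I_K * {set 'I_K} * {set 'I_K}) := window_pattern m tau.1.2 tau.2 tau.1.1.
pose gs tau := [seq pattern_symbol tau.1.1 e | e <- pat tau].
pose good (tau : 'I_K * {set 'I_K} * {set 'I_K}) (nu : R) := 0 < nu /\
  ((0 < size (pat tau))%N ->
  forall (disp : measure_display) (Omega : measurableType disp)
    (P : probability Omega R) (N : clock K -> R -> Omega -> nat)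
    (U : clock K -> nat -> {RV P >-> R}),
  (forall c, poisson_process P (rate d v b c) (N c)) ->
  (forall c n B, measurable B ->
    distribution P (U c n) B = uniform_prob (@ltr01 R) B) ->
  mutually_independent P (fun a : clock K + clock K * nat =>
    match a with
    | inl c => sigma_process (N c)
    | inr (c, n) => sigma_var (U c n)
    end) ->
  exists G : set Omega, [/\ measurable G, (0 < P G)%E &
    forall omega, G omega -> forall n,
      window N U (move_clock tau.1.1) (size (pat tau)) n omega = gs tau \/
      (\sum_c N c (n.+1 * size (pat tau))%:R omega + K)%N%:R <= nu *
      (\sum_(k < n) (window N U (move_clock tau.1.1) (size (pat tau)) k omega == gs tau))%N%:R]).
have /choice[f f_good] : forall tau, exists nu, good tau nu.
  move=> tau; have [p0|p0] := posnP (size (pat tau)).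
    by exists 1; split; rewrite // p0.
  (* The slack is K because there are at most K births, each costing w0. *)
  have [nu nu0 nuP] := window_rewards_const K rates0 p0 (size_map _ _)
    (@pattern_symbol_gt0 R m K _ tau.1.2 tau.2 tau.1.1 rates0).
  by exists nu; split.
(* The sum dominates each constant [f tau] and also each window length, as [window_survival]
   requires. *)
pose nu : R := 1 + \sum_tau (f tau + (size (pat tau))%:R).
have f0 tau : 0 < f tau by have [] := f_good tau.
have nu0 : 0 < nu.
  by rewrite ltr_pwDl// sumr_ge0// => tau _; rewrite addr_ge0// ltW.
have nu_ge tau : f tau + (size (pat tau))%:R <= nu.
  rewrite /nu (bigD1 tau)//= addrCA lerDl addr_ge0// sumr_ge0// => tau' _.
  by rewrite addr_ge0// ltW.
exists nu, nu; split=> // pay payR0 payRT payP0 payPS nuR nuT s0 C2 D1.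
move=> disp Omega P st [N [U [[poisson_N uniform_U] indep [meas_st st0] st_const st_jump]]].
have payT0 := lt_trans payR0 payRT; have payS0 := lt_trans payP0 payPS.
pose C : {set 'I_K} := finset (fun i => is_coop (strat (s0 i)) && (0 < wealth (s0 i))).
pose D : {set 'I_K} := finset (fun i => is_def (strat (s0 i)) && (0 < wealth (s0 i))).
have {}C2 : (1 < #|C|)%N by rewrite cardsE.
have [i0 i0C] : exists i0, i0 \in C by apply/card_gt0P; exact: ltnW.
pose tau := (i0, C, D).
have H0 : (0 < size (pat tau))%N by exact: (window_pattern_gt0 D i0C m_ge1).
have [_ /(_ H0 disp Omega P N U poisson_N uniform_U indep)[G [mG PG GP]]] := f_good tau.
have [Z [mZ PZ ZP]] := no_simultaneous_rings rates0 poisson_N (mutually_independent_inl indep).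
have right_cont c omega t : 0 <= t -> \forall s \near t^'+, N c s omega = N c t omega.
  by have [_ _ [_ rc] _ _] := poisson_N c; exact: rc.
have mS : measurable (survival s0 st).
  apply: (measurable_survival s0 _ right_cont st_const) => t i t0.
  by have [_ mw _] := meas_st t i t0.
(* Removing the null set of simultaneous rings leaves the probability of G unchanged; outside it,
   the path argument applies to each omega separately. *)
have PGZ : P (G `\` Z) = P G.
  have GZ0 : P (G `&` Z) = 0.
    by apply/eqP; rewrite eq_le measure_ge0 andbT -PZ; exact: measureIr.
  have -> : P G = (P (G `\` Z) + P (G `&` Z))%E by exact: measureDI.
  by rewrite GZ0 adde0.
apply: (@lt_le_trans _ _ (P (G `\` Z))); first by rewrite PGZ.
apply: le_measure; rewrite ?inE//; first exact: measurableD.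
move=> omega [Gomega notZ] t i t0 ai.
have N_le c s u : 0 <= s -> s <= u -> (N c s omega <= N c u omega)%N.
  by have [_ _ [mon _] _ _] := poisson_N c; exact: mon.
have alive0 : all_alive C D (st 0 omega).
  rewrite st0; split=> j; rewrite inE => /andP[zj wj]; split=> //.
    by case: (strat (s0 j)) zj.
  by case: (strat (s0 j)) zj.
have iCD : i \in C :|: D.
  move: ai; rewrite finset.in_setU !inE /alive.
  by case: (strat (s0 i)) => //= ->.
have nuE : f tau <= nu.
  by apply: le_trans (nu_ge tau); rewrite lerDl.
have sizeE : (size (pat tau))%:R <= nu.
  by apply: le_trans (nu_ge tau); rewrite lerDr ltW.
pose perfectb n := window N U (move_clock i0) (size (pat tau)) n omega == gs tau.
have perfE n : perfectb n ->
    perfect_window (R := R) m (fun c t => N c t omega) (fun c k => U c k omega) C D i0 n.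
  by move=> /eqP winE; exact: (perfect_window_symbols winE).
have goodE n : perfectb n \/
    (total_rings (fun c t => N c t omega) (n.+1 * size (pat tau))%:R + K)%N%:R <=
    nu * (\sum_(k < n) perfectb k)%N%:R.
  have [winE|le_n] := GP omega Gomega n; [by left; apply/eqP|right].
  by apply: le_trans le_n _; rewrite ler_wpM2r.
have total0 : total_rings (fun c t => N c t omega) 0 = 0%N.
  by rewrite /total_rings big1// => c _; have [_ -> _ _ _] := poisson_N c.
have aliveT := @window_survival R m K w0 wc pay (fun c t => N c t omega)
  (fun c k => U c k omega) (fun t => st t omega) payR0 payT0 payS0 payP0 w0_gt0 N_le
  (st_const omega) (st_jump omega) (ZP omega notZ) C D i0 i0C C2 alive0 H0
  nu perfectb perfE goodE total0 sizeE nuR nuT t t0.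
by have /andP[] := alive_in aliveT iCD.
Qed.
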